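(* Let $w\in\Sigma_n$ be a finite permutation. Then $$\mathfrak{G}_w(x)=\sum_{T}(-1)^{|T|-\ell(w)}x^T,$$ where the sum is over all column-strict set-valued balanced labellings $T$ of $D(w)$ such that $t\le i$ for every box $(i,j)\in D(w)$ and every label $t\in T(i,j)$. Here $\mathfrak{G}_w$ is the Grothendieck polynomial of Lascoux and Schützenberger and $x^T=\prod_{b\in D(w)}\prod_{k\in T(b)}x_k$.
   Context: $\Sigma_n$ is the group of permutations of $\{1,\dots,n\}$, $s_i$ ($1\le i\le n-1$) is the transposition of $i$ and $i+1$, and $\ell(w)$ is the number of inversions of $w$. $ws_i$ is obtained from the one-line notation of $w$ by switching the entries in positions $i$ and $i+1$. Grothendieck polynomials: $\mathfrak{G}_{w_0}=x_1^{n-1}x_2^{n-2}\cdots x_{n-1}$ for $w_0=[n,n-1,\dots,1]$, and $\mathfrak{G}_{ws_i}=\pi_i\mathfrak{G}_w$ whenever $w(i)>w(i+1)$, where $\pi_if=\frac{(1-x_{i+1})f-(1-x_i)\,s_if}{x_i-x_{i+1}}$ and $s_i$ acts on polynomials by exchanging $x_i$ and $x_{i+1}$. Equivalently (Fomin–Kirillov), $\mathfrak{G}_w=\sum(-1)^{\sum_i\ell(v_i)-\ell(w)}x_1^{\ell(v_1)}x_2^{\ell(v_2)}\cdots$, summed over factorizations $u_w=u_{v_1}u_{v_2}\cdots$ (those differing only by trailing identity factors being identified) in the algebra with generators $u_1,\dots,u_{n-1}$ satisfying $u_i^2=u_i$, $u_iu_{i+1}u_i=u_{i+1}u_iu_{i+1}$,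 $u_iu_j=u_ju_i$ for $|i-j|\ge2$ (with $u_v=u_{i_1}\cdots u_{i_\ell}$ for a reduced word $i_1\cdots i_\ell$ of $v$), where each $v_i$ has a decreasing reduced word all of whose letters are $\ge i$. $D(w)=\{(i,w(j)) : 1\le i<j\le n,\ w(i)>w(j)\}$ is the (Rothe) diagram; elements are boxes, with the first coordinate the row (increasing southward) and the second the column (increasing eastward). A set-valued labelling $T$ assigns to each box a nonempty finite subset of $\mathbb{Z}_{>0}$; $|T|=\sum_{b\in D(w)}|T(b)|$. $T$ is column-strict if $T(a)\cap T(b)=\emptyset$ for distinct boxes $a,b$ in the same column. Balancedness: for a box $a$ of a (sub)diagram, its hook $H_a$ consists of $a$, the boxes $b_i$ to the right of $a$ in its row, and the boxes $c_j$ below $a$ in its column. Let $\mathrm{rmin}_a=\min\bigcup_iT(b_i)$, $\mathrm{bmin}_a=\min\bigcup_jT(c_j)$, with $\min\emptyset=\infty$. From each box of $H_a$ one may pick one label as follows: from $a$, any element of $T(a)$; from $b_i$, either $\min T(b_i)$ or any $x\in T(b_i)$ with $x\le\mathrm{bmin}_a$; from $c_j$, either $\min T(c_j)$ or any $y\in T(c_j)$ with $y\le\mathrm{rmin}_a$. $H_a$ is balanced if for every such choice of one label in each box, the resulting single-valued hook is balanced: rearranging its labels so that they weakly increase from right to left along the row part and then from top to bottom along the column part leaves the corner label (that of $a$) unchanged. $T$ is balanced if for all $1\le i<j<k\le n$, in the subdiagram of $D(w)$ consisting of its boxes in rows $i,j,k$ and columns $w(i),w(j),w(k)$ (with the restriction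 of $T$), every hook is balanced, hooks being taken within this subdiagram.
   Formalization: In the hook choice rule, a non-minimal label x from a box b_i to the right of a is allowed only if x < bmin_a, instead of x ≤ bmin_a; with ≤ the identity fails for w=[1,4,3,2], where the coefficient of x_1^2x_2^2 is -1 on the left and 0 on the right. *)

(* Defs.v *)
From HB Require Import structures.
From mathcomp Require Import all_boot all_order all_algebra all_fingroup.
From mathcomp Require Import ring zify.
From mathcomp.multinomials Require Import mpoly.

Set Implicit Arguments.
Unset Strict Implicit.
Unset Printing Implicit Defensive.

Import GRing.Theory.
Local Open Scope ring_scope.

(* Rows, columns and positions {1,...,n} are encoded as 'I_n = {0,...,n-1},
   and a label t as t-1, so that the variable x_t is 'X_(t-1).
   In mathcomp (s * u)%g x = u (s x): with s_i = tperm i j, j = i + 1, the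
   permutation w s_i obtained by switching the entries of w in positions i and
   i + 1 is (tperm i j * w)%g. *)

Section Algebra.
Variable R : idomainType.
Implicit Types x y z : R.

Lemma sdiv_mul x y (p q sp sq p1 q1 : R) :
  (x - y) * p1 = p - sp -> (x - y) * q1 = q - sq ->
  (x - y) * (p1 * q + sp * q1) = p * q - sp * sq.
Proof.
move=> Hp Hq.
have -> : (x - y) * (p1 * q + sp * q1)
  = (x - y) * p1 * q + sp * ((x - y) * q1) by ring.
by rewrite Hp Hq; ring.
Qed.

Lemma isobaric_comm_aux x y z t (f sf tf stf a sa b tb c d : R) :
  x != y -> z != t ->
  (x - y) * b = (1 - y) * f - (1 - x) * sf ->
  (x - y) * tb = (1 - y) * tf - (1 - x) * stf ->
  (z - t) * a = (1 - t) * f - (1 - z) * tf ->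
  (z - t) * sa = (1 - t) * sf - (1 - z) * stf ->
  (x - y) * c = (1 - y) * a - (1 - x) * sa ->
  (z - t) * d = (1 - t) * b - (1 - z) * tb -> c = d.
Proof.
rewrite -(subr_eq0 x) -(subr_eq0 z) => xy zt Hb Htb Ha Hsa Hc Hd.
apply: (mulfI (mulf_neq0 xy zt)).
have -> : (x - y) * (z - t) * c = (z - t) * ((x - y) * c) by ring.
have -> : (x - y) * (z - t) * d = (x - y) * ((z - t) * d) by ring.
rewrite Hc Hd.
have -> : (z - t) * ((1 - y) * a - (1 - x) * sa)
  = (1 - y) * ((z - t) * a) - (1 - x) * ((z - t) * sa) by ring.
have -> : (x - y) * ((1 - t) * b - (1 - z) * tb)
  = (1 - t) * ((x - y) * b) - (1 - z) * ((x - y) * tb) by ring.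
by rewrite Ha Hsa Hb Htb; ring.
Qed.

(* f, sf, ... are the images of a polynomial under the permutations of the
   variables x, y, z generated by s = (x y) and t = (y z). *)
Lemma isobaric3 x y z (f sf tf stf tsf stsf a ta sa sta b sb c : R) :
  x != y ->
  (x - y) * a = (1 - y) * f - (1 - x) * sf ->
  (x - z) * ta = (1 - z) * tf - (1 - x) * tsf ->
  (y - x) * sa = (1 - x) * sf - (1 - y) * f ->
  (y - z) * sta = (1 - z) * stf - (1 - y) * stsf ->
  (y - z) * b = (1 - z) * a - (1 - y) * ta ->
  (x - z) * sb = (1 - z) * sa - (1 - x) * sta ->
  (x - y) * c = (1 - y) * b - (1 - x) * sb ->
  (x - y) * (y - z) * (x - z) * c =
    (1 - y) * (1 - z) ^+ 2 * f - (1 - x) * (1 - z) ^+ 2 * sf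
    - (1 - z) * (1 - y) ^+ 2 * tf + (1 - z) * (1 - x) ^+ 2 * stf
    + (1 - x) * (1 - y) ^+ 2 * tsf - (1 - y) * (1 - x) ^+ 2 * stsf.
Proof.
rewrite -(subr_eq0 x) => xy Ha Hta Hsa Hsta Hb Hsb Hc.
apply: (mulfI xy).
set rhs := (X in _ = (x - y) * X).
have -> : (x - y) * ((x - y) * (y - z) * (x - z) * c)
  = (x - y) * (y - z) * (x - z) * ((x - y) * c) by ring.
rewrite Hc.
have -> : (x - y) * (y - z) * (x - z) * ((1 - y) * b - (1 - x) * sb)
  = (1 - y) * (x - y) * (x - z) * ((y - z) * b)
    - (1 - x) * (x - y) * (y - z) * ((x - z) * sb) by ring.
rewrite Hb Hsb.
have -> : (1 - y) * (x - y) * (x - z) * ((1 - z) * a - (1 - y) * ta)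
    - (1 - x) * (x - y) * (y - z) * ((1 - z) * sa - (1 - x) * sta)
  = (1 - y) * (x - z) * (1 - z) * ((x - y) * a)
    - (1 - y) ^+ 2 * (x - y) * ((x - z) * ta)
    + (1 - x) * (y - z) * (1 - z) * ((y - x) * sa)
    + (1 - x) ^+ 2 * (x - y) * ((y - z) * sta) by ring.
by rewrite Ha Hta Hsa Hsta /rhs; ring.
Qed.

Lemma isobaric3' x y z (f sf tf stf tsf stsf a ta sa tsa b tb c : R) :
  y != z ->
  (y - z) * a = (1 - z) * f - (1 - y) * tf ->
  (x - z) * sa = (1 - z) * sf - (1 - x) * stf ->
  (z - y) * ta = (1 - y) * tf - (1 - z) * f ->
  (x - y) * tsa = (1 - y) * tsf - (1 - x) * stsf ->
  (x - y) * b = (1 - y) * a - (1 - x) * sa ->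
  (x - z) * tb = (1 - z) * ta - (1 - x) * tsa ->
  (y - z) * c = (1 - z) * b - (1 - y) * tb ->
  (x - y) * (y - z) * (x - z) * c =
    (1 - y) * (1 - z) ^+ 2 * f - (1 - x) * (1 - z) ^+ 2 * sf
    - (1 - z) * (1 - y) ^+ 2 * tf + (1 - z) * (1 - x) ^+ 2 * stf
    + (1 - x) * (1 - y) ^+ 2 * tsf - (1 - y) * (1 - x) ^+ 2 * stsf.
Proof.
rewrite -(subr_eq0 y) => yz Ha Hsa Hta Htsa Hb Htb Hc.
apply: (mulfI yz).
set rhs := (X in _ = (y - z) * X).
have -> : (y - z) * ((x - y) * (y - z) * (x - z) * c)
  = (x - y) * (y - z) * (x - z) * ((y - z) * c) by ring.
rewrite Hc.
have -> : (x - y) * (y - z) * (x - z) * ((1 - z) * b - (1 - y) * tb)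
  = (1 - z) * (y - z) * (x - z) * ((x - y) * b)
    - (1 - y) * (x - y) * (y - z) * ((x - z) * tb) by ring.
rewrite Hb Htb.
have -> : (1 - z) * (y - z) * (x - z) * ((1 - y) * a - (1 - x) * sa)
    - (1 - y) * (x - y) * (y - z) * ((1 - z) * ta - (1 - x) * tsa)
  = (1 - z) * (x - z) * (1 - y) * ((y - z) * a)
    - (1 - z) * (1 - x) * (y - z) * ((x - z) * sa)
    + (1 - y) * (x - y) * (1 - z) * ((z - y) * ta)
    + (1 - y) * (1 - x) * (y - z) * ((x - y) * tsa) by ring.
by rewrite Ha Hta Hsa Htsa /rhs; ring.
Qed.
End Algebra.

Section Divisibility.
Variable n : nat.
Implicit Types (f g : {mpoly int[n]}) (i j k : 'I_n).

Lemma msymXU (s : 'S_n) k : msym s 'X_k = 'X_(s k) :> {mpoly int[n]}.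
Proof. by rewrite /msym mmapX mmap1U. Qed.

Lemma msym_subr_dvd i j f :
  exists g, ('X_i - 'X_j) * g = f - msym (tperm i j) f.
Proof.
pose P f := exists g, ('X_i - 'X_j) * g = f - msym (tperm i j) f.
have PM p q : P p -> P q -> P (p * q).
  move=> [p1 Hp] [q1 Hq]; exists (p1 * q + msym (tperm i j) p * q1).
  by rewrite msymM; apply: sdiv_mul.
have P1 : P 1 by exists 0; rewrite mulr0 msym1 subrr.
have PXU k : P 'X_k.
  rewrite /P msymXU; case: tpermP => [->|->|_ _].
  - by exists 1; rewrite mulr1.
  - by exists (-1); rewrite mulrN1 opprB.
  - by exists 0; rewrite mulr0 subrr.
elim/mpolyind: f => [|c m p _ _ [g Hg]].
  by exists 0; rewrite msym0 mulr0 subrr.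
have [h Hh] : P 'X_[m].
  rewrite mpolyXE_id; elim/big_ind: _ => // k _.
  by elim: (m k) => [|d IH]; rewrite ?expr0 // exprS; apply: PM.
exists (c *: h + g).
by rewrite mulrDr -scalerAr Hh Hg msymD msymZ scalerBr opprD addrACA.
Qed.

Lemma isobaric_dvd i j f :
  exists g, ('X_i - 'X_j) * g
            == (1 - 'X_j) * f - (1 - 'X_i) * msym (tperm i j) f.
Proof.
have [g Hg] := msym_subr_dvd i j ((1 - 'X_j) * f).
by exists g; rewrite Hg msymM msymB msym1 msymXU tpermR.
Qed.

End Divisibility.

(* The exact quotient of (1 - 'X_j) f - (1 - 'X_i) s_ij f by 'X_i - 'X_j;
   see isobaricE. *)
HB.lock Definition isobaric n (i j : 'I_n) (f : {mpoly int[n]}) :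
  {mpoly int[n]} := xchoose (isobaric_dvd i j f).

Section Isobaric.
Variable n : nat.
Implicit Types (f g : {mpoly int[n]}) (i j k l : 'I_n).

Lemma isobaricE i j f :
  ('X_i - 'X_j) * isobaric i j f =
  (1 - 'X_j) * f - (1 - 'X_i) * msym (tperm i j) f.
Proof.
by rewrite isobaric.unlock; apply/eqP/(xchooseP (isobaric_dvd i j f)).
Qed.

Lemma mpolyXU_neq i j : i != j -> 'X_i != 'X_j :> {mpoly int[n]}.
Proof.
apply: contraNneq => /(congr1 (mcoeff U_(i)%MM)); rewrite !mcoeffX eqxx.
case: eqP => // /mnmP/(_ i); rewrite !mnm1E eqxx eq_sym.
by case: (i == j).
Qed.

Lemma msym_isobaric (s : 'S_n) i j f :
  ('X_(s i) - 'X_(s j)) * msym s (isobaric i j f) =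
  (1 - 'X_(s j)) * msym s f - (1 - 'X_(s i)) * msym s (msym (tperm i j) f).
Proof.
by have /(congr1 (msym s)) := isobaricE i j f;
   rewrite !(msymM, msymB, msym1, msymXU).
Qed.

Lemma msym_tpermK i j : involutive (@msym n int (tperm i j)).
Proof. by move=> f; rewrite -msymMm tperm2 msym1m. Qed.

Lemma isobaric_comm i j k l f :
  i != j -> k != l -> i != k -> i != l -> j != k -> j != l ->
  isobaric i j (isobaric k l f) = isobaric k l (isobaric i j f).
Proof.
move=> ij kl ik il jk jl.
have st p : msym (tperm k l) (msym (tperm i j) p)
            = msym (tperm i j) (msym (tperm k l) p) :> {mpoly int[n]}.
  rewrite -!msymMm; congr (msym _ _); apply/permP => x; rewrite !permM.
  case: (tpermP i j x) => [->|->|xi xj].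
  - by rewrite ![tperm k l _]tpermD 1?eq_sym // tpermL.
  - by rewrite ![tperm k l _]tpermD 1?eq_sym // tpermR.
  - case: (tpermP k l x) => [_|_|_ _]; rewrite tpermD //;
      by apply/eqP=> e; by [case: xi | case: xj].
have E1 := msym_isobaric (tperm k l) i j f.
have E2 := msym_isobaric (tperm i j) k l f.
have nikl : tperm k l i = i by rewrite tpermD // eq_sym.
have njkl : tperm k l j = j by rewrite tpermD // eq_sym.
have nkij : tperm i j k = k by rewrite tpermD.
have nlij : tperm i j l = l by rewrite tpermD.
rewrite nikl njkl st in E1; rewrite nkij nlij in E2.
exact: (isobaric_comm_aux (mpolyXU_neq ij) (mpolyXU_neq kl)
  (isobaricE i j f) E1 (isobaricE k l f) E2 (isobaricE i j _)
  (isobaricE k l _)).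
Qed.

Lemma tperm_braid i j k : i != j -> j != k -> i != k ->
  (tperm i j * tperm j k * tperm i j = tperm j k * tperm i j * tperm j k)%g.
Proof.
move=> ij jk ik.
have -> : (tperm i j * tperm j k * tperm i j)%g = tperm i k.
  by rewrite -{1}(tpermV i j) -mulgA -conjgE tpermJ tpermR tpermD.
by rewrite -{1}(tpermV j k) -mulgA -conjgE tpermJ tpermL tpermD // eq_sym.
Qed.

Lemma isobaric_braid i j k f : i != j -> j != k -> i != k ->
  isobaric i j (isobaric j k (isobaric i j f)) =
  isobaric j k (isobaric i j (isobaric j k f)).
Proof.
move=> ij jk ik.
set s := tperm i j; set t := tperm j k.
have si : s i = j by rewrite tpermL.
have sj : s j = i by rewrite tpermR.
have sk : s k = k by rewrite tpermD.
have ti : t i = i by rewrite tpermD // eq_sym.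
have tj : t j = k by rewrite tpermL.
have tk : t k = j by rewrite tpermR.
have ss : involutive (@msym n int s) by apply: msym_tpermK.
have tt : involutive (@msym n int t) by apply: msym_tpermK.
have sts p : msym s (msym t (msym s p)) = msym t (msym s (msym t p))
    :> {mpoly int[n]}.
  by rewrite -!msymMm mulgA tperm_braid // mulgA.
have X p := isobaricE i j p; have Y p := isobaricE j k p.
have Xs p := msym_isobaric s i j p; have Ys p := msym_isobaric s j k p.
have Xt p := msym_isobaric t i j p; have Yt p := msym_isobaric t j k p.
rewrite -/s in X Xs Xt; rewrite -/t in Y Ys Yt.
have Xst p := congr1 (msym s) (Xt p); have Yts p := congr1 (msym t) (Ys p).
have {}Xs p := Xs p; have {}Xt p := Xt p.
have XX := mpolyXU_neq ij; have YY := mpolyXU_neq jk.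
have ZZ := mpolyXU_neq ik.
have nz : ('X_i - 'X_j) * ('X_j - 'X_k) * ('X_i - 'X_k) != 0 :> {mpoly int[n]}.
  by rewrite !mulf_neq0 // subr_eq0.
apply: (mulfI nz).
have E1 := Xs f; rewrite si sj ss in E1.
have E2 := Xt f; rewrite ti tj in E2.
have E3 := Xst f.
rewrite !(msymM, msymB, msym1, msymXU) ti tj si sk in E3.
have E4 := Ys (isobaric i j f); rewrite sj sk in E4.
have F1 := Yt f; rewrite tj tk tt in F1.
have F2 := Ys f; rewrite sj sk in F2.
have F3 := Yts f.
rewrite !(msymM, msymB, msym1, msymXU) sj sk ti tk in F3.
have F4 := Xt (isobaric j k f); rewrite ti tj in F4.
rewrite sts in E3.
have C1 := @isobaric3 _ 'X_i 'X_j 'X_k f (msym s f) (msym t f)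
  (msym s (msym t f)) (msym t (msym s f)) _ _ _ _ _ _ _ _
  XX (X f) E2 E1 E3 (Y _) E4 (X _).
have C2 := @isobaric3' _ 'X_i 'X_j 'X_k f (msym s f) (msym t f)
  (msym s (msym t f)) (msym t (msym s f)) _ _ _ _ _ _ _ _
  YY (Y f) F2 F1 F3 (X _) F4 (Y _).
by apply: etrans C1 (esym C2).
Qed.
End Isobaric.

Section Grothendieck.
Variable n : nat.
Implicit Types (w : 'S_n) (i j k l : 'I_n).

(* w(i) < w(j) at adjacent positions i, j = i + 1. *)
Definition ascent w i j := (j == i.+1 :> nat) && (w i < w j)%N.

Definition w0 : 'S_n := perm (@rev_ord_inj n).

Definition groth_w0 : {mpoly int[n]} := \prod_(i < n) 'X_i ^+ (n - i.+1).

Fixpoint groth_rec (fuel : nat) w : {mpoly int[n]} :=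
  if fuel isn't fuel'.+1 then groth_w0 else
  if [pick p : 'I_n * 'I_n | ascent w p.1 p.2] is Some (i, j)
  then isobaric i j (groth_rec fuel' (tperm i j * w)%g)
  else groth_w0.

(* Computed along one chain from w0 to w; by grothendieck_w0 and
   grothendieck_step it is the family defined by G_(w0) = groth_w0 and
   G_(w s_i) = pi_i G_w for all w and i with w(i) > w(i+1). *)
Definition grothendieck w := groth_rec (n * n) w.

Definition noninv w : {set 'I_n * 'I_n} :=
  [set p : 'I_n * 'I_n | (p.1 < p.2)%N && (w p.1 < w p.2)%N].

Lemma noninv_ltn w i j : ascent w i j ->
  (#|noninv (tperm i j * w)%g| < #|noninv w|)%N.
Proof.
case/andP=> /eqP ij wij; set s := tperm i j.
have inj : injective (fun p : 'I_n * 'I_n => (s p.1, s p.2)).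
  by move=> [a b] [c d] /= [/perm_inj -> /perm_inj ->].
rewrite -(card_imset _ inj).
have ijN : (i, j) \in noninv w by rewrite inE /= wij ij ltnSn.
rewrite [X in (_ < X)%N](cardsD1 (i, j)) ijN ltnS; apply: subset_leq_card.
apply/subsetP => _ /imsetP[[a b] + ->]; rewrite !inE /= !permM.
move=> /andP[ab wab]; rewrite wab andbT xpair_eqE.
have ne x y : x <> y :> 'I_n -> x <> y :> nat by move=> h /val_inj.
rewrite /s; case: (tpermP i j a) ab wab => [->|->|/ne ai /ne aj];
  case: (tpermP i j b) => [->|->|/ne bi /ne bj] ab wab;
  rewrite -?val_eqE /=; move: ab wab ij; lia.
Qed.

Lemma groth_rec_fuel m m' w : (#|noninv w| <= m)%N -> (#|noninv w| <= m')%N ->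
  groth_rec m w = groth_rec m' w.
Proof.
have stop w' : #|noninv w'| = 0%N -> forall m, groth_rec m w' = groth_w0.
  move=> e [|k] //=; case: pickP => // -[i j] /= asc.
  by have := noninv_ltn asc; rewrite e.
elim: m m' w => [|m IH] m' w.
  by rewrite leqn0 => /eqP /stop e _; rewrite !e.
case: m' => [|m'] hm hm'.
  by move: hm'; rewrite leqn0 => /eqP /stop e; rewrite !e.
rewrite /=; case: pickP => // -[i j] /= /noninv_ltn lt.
by rewrite (IH m') // -ltnS (leq_trans lt).
Qed.

Lemma noninv_leq w : (#|noninv w| <= n * n)%N.
Proof. by apply: (leq_trans (max_card _)); rewrite card_prod card_ord. Qed.

Lemma grothendieck_pick w : grothendieck w =
  if [pick p : 'I_n * 'I_n | ascent w p.1 p.2] is Some (i, j)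
  then isobaric i j (grothendieck (tperm i j * w)%g) else groth_w0.
Proof.
have -> : grothendieck w = groth_rec (n * n).+1 w; last by [].
apply: groth_rec_fuel; last apply: leqW; exact: noninv_leq.
Qed.

Lemma grothendieck_w0 : grothendieck w0 = groth_w0.
Proof.
rewrite grothendieck_pick; case: pickP => // -[i j] /=.
by rewrite /ascent /w0 !permE /=; lia.
Qed.

Lemma ascent_neq w i j : ascent w i j -> i != j.
Proof. by case/andP => /eqP ij _; rewrite -val_eqE /= ij; lia. Qed.

Let step_at w i j :=
  grothendieck w = isobaric i j (grothendieck (tperm i j * w)%g).

Lemma step_adjacent w i j k : ascent w i j -> ascent w j k ->
  (forall w' a b, (#|noninv w'| < #|noninv w|)%N -> ascent w' a b ->
     step_at w' a b) ->
  isobaric i j (grothendieck (tperm i j * w)%g) =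
  isobaric j k (grothendieck (tperm j k * w)%g).
Proof.
move=> aij ajk IH.
have nij := ascent_neq aij; have njk := ascent_neq ajk.
have [/andP[/eqP ij wij] /andP[/eqP jk wjk]] := (aij, ajk).
have nik : i != k by rewrite -val_eqE /= jk ij; lia.
have [sk ti] : tperm i j k = k /\ tperm j k i = i.
  by rewrite !tpermD // eq_sym.
have l1 := noninv_ltn aij; have r1 := noninv_ltn ajk.
have al1 : ascent (tperm i j * w)%g j k.
  by rewrite /ascent !permM tpermR sk jk eqxx (ltn_trans wij).
have ar1 : ascent (tperm j k * w)%g i j.
  by rewrite /ascent !permM tpermL ti ij eqxx (ltn_trans wij).
have l2 := ltn_trans (noninv_ltn al1) l1.
have r2 := ltn_trans (noninv_ltn ar1) r1.
have al2 : ascent (tperm j k * (tperm i j * w))%g i j.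
  by rewrite /ascent !permM ti tpermL tpermL sk ij eqxx.
have ar2 : ascent (tperm i j * (tperm j k * w))%g j k.
  by rewrite /ascent !permM sk !tpermR ti jk eqxx.
rewrite (IH _ _ _ l1 al1) (IH _ _ _ l2 al2) isobaric_braid //.
rewrite (IH _ _ _ r1 ar1) (IH _ _ _ r2 ar2).
by rewrite !mulgA tperm_braid.
Qed.

Lemma step_ascent w i j : ascent w i j -> step_at w i j.
Proof.
have [m] := ubnP #|noninv w|.
elim: m w i j => // m IHm w i j; rewrite ltnS => lm aij.
have IH w' a b :
    (#|noninv w'| < #|noninv w|)%N -> ascent w' a b -> step_at w' a b.
  by move=> lw; apply: IHm; apply: leq_trans lw lm.
rewrite /step_at grothendieck_pick; case: pickP => [[k l] /= akl|/(_ (i, j))];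
  last by rewrite /= aij.
have [/andP[/eqP ij wij] /andP[/eqP kl wkl]] := (aij, akl).
case: (eqVneq k i) => [ki|].
  by have -> : l = j by [apply: val_inj; rewrite /= kl ki ij]; rewrite ki.
case: (eqVneq l i) => [li _|nli nki].
  by rewrite li in akl *; apply: step_adjacent.
case: (eqVneq j k) => [jk|njk].
  by rewrite -jk in akl *; rewrite (step_adjacent aij akl IH).
have nlj : l != j.
  apply: contraNneq nki => lj; apply/eqP/val_inj/succn_inj.
  by rewrite -kl -ij lj.
have [nij nkl] := (ascent_neq aij, ascent_neq akl).
have d1 : tperm k l i = i by rewrite tpermD // eq_sym.
have d2 : tperm k l j = j by rewrite tpermD // eq_sym.
have d3 : tperm i j k = k by rewrite tpermD // eq_sym.
have d4 : tperm i j l = l by rewrite tpermD // eq_sym.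
rewrite (IH (tperm k l * w)%g i j (noninv_ltn akl)); last first.
  by rewrite /ascent !permM d1 d2.
rewrite (IH (tperm i j * w)%g k l (noninv_ltn aij)); last first.
  by rewrite /ascent !permM d3 d4.
rewrite isobaric_comm // 1?eq_sym //.
congr (isobaric i j (isobaric k l (grothendieck _))).
rewrite !mulgA; congr (_ * w)%g.
apply/permP => x; rewrite !permM.
by case: (tpermP i j x) => [->|->|xi xj]; rewrite ?d1 ?d2 ?tpermL ?tpermR //;
   case: (tpermP k l x) => [_|_|_ _]; rewrite ?d3 ?d4 // tpermD //;
   apply/eqP=> e; by [case: xi | case: xj].
Qed.

(* For w(i) > w(j), j = i + 1. *)
Lemma grothendieck_step w i j : j = i.+1 :> nat -> (w j < w i)%N ->
  grothendieck (tperm i j * w)%g = isobaric i j (grothendieck w).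
Proof.
move=> ij wji; have := @step_ascent (tperm i j * w)%g i j.
rewrite /step_at mulgA tperm2 mul1g; apply.
by rewrite /ascent !permM tpermL tpermR ij eqxx.
Qed.
End Grothendieck.

Section Labellings.
Variable n : nat.
Implicit Types (w : 'S_n) (i j k : 'I_n).

(* (row, column) *)
Local Notation box := ('I_n * 'I_n)%type.

(* Labellings of a diagram are extended by set0 to all boxes.  The condition
   t <= i on the labels of row i confines them to {1,...,n}, so they are taken
   in 'I_n. *)
Definition labelling := {ffun box -> {set 'I_n}}.

Implicit Types (S : {set box}) (T : labelling) (a b : box).

Definition inversions w : {set 'I_n * 'I_n} :=
  [set p : 'I_n * 'I_n | (p.1 < p.2)%N && (w p.2 < w p.1)%N].

Definition ell w : nat := #|inversions w|.

Definition diagram w : {set box} := [set (p.1, w p.2) | p in inversions w].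

Definition set_valued w T : bool :=
  [forall b, (b \in diagram w) == (T b != set0)].

Definition label_count w T : nat := (\sum_(b in diagram w) #|T b|)%N.

Definition label_monomial w T : {mpoly int[n]} :=
  \prod_(b in diagram w) \prod_(t in T b) 'X_t.

Definition column_strict w T : bool :=
  [forall a in diagram w, forall b in diagram w,
     (a != b) && (a.2 == b.2) ==> [disjoint T a & T b]].

Definition flagged w T : bool :=
  [forall b in diagram w, forall t in T b, (t <= b.1)%N].

(* The empty minimum is n, which exceeds every label and plays the role of
   infinity. *)
Definition min_label (A : {set 'I_n}) : nat := \big[minn/n]_(t in A) (t : nat).

(* Boxes of S to the right of a in its row, read from right to left. *)
Definition arm S a : seq box :=
  [seq b <- [seq (a.1, c) | c <- rev (enum 'I_n)] | (b \in S) && (a.2 < b.2)%N].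

(* Boxes of S below a in its column, read from top to bottom. *)
Definition leg S a : seq box :=
  [seq b <- [seq (r, a.2) | r <- enum 'I_n] | (b \in S) && (a.1 < b.1)%N].

Definition hook S a : seq box := arm S a ++ a :: leg S a.

Definition rmin S T a : nat := min_label (\bigcup_(b <- arm S a) T b).
Definition bmin S T a : nat := min_label (\bigcup_(b <- leg S a) T b).

(* x picks a label in each box of the hook of a; its values at the other boxes
   are irrelevant.
   The bound is strict on the arm and weak on the leg.  If x b = bmin were also
   allowed on the arm, the expansion of G_w would fail for w = [1,4,3,2]: the
   labelling {1} at (2,2), {1,2} at (2,3), {2} at (3,2) would not be balanced,
   although it alone accounts for the term - x_1^2 x_2^2 of G_w. *)
Definition admissible S T a (x : {ffun box -> 'I_n}) : bool :=
  [&& x a \in T a,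
      all (fun b => (x b \in T b) &&
             ((x b == min_label (T b) :> nat) || (x b < bmin S T a)%N))
          (arm S a)
    & all (fun c => (x c \in T c) &&
             ((x c == min_label (T c) :> nat) || (x c <= rmin S T a)%N))
          (leg S a)].

(* hook S a lists the boxes in the order along which the rearranged labels
   must weakly increase; the corner has index size (arm S a). *)
Definition hook_balanced S T a : bool :=
  [forall x : {ffun box -> 'I_n}, admissible S T a x ==>
    (nth 0 (sort leq [seq (x b : nat) | b <- hook S a]) (size (arm S a))
     == x a)%N].

Definition subdiagram w i j k : {set box} :=
  [set b in diagram w | (b.1 \in [:: i; j; k]) && (b.2 \in [:: w i; w j; w k])].

Definition balanced w T : bool :=
  [forall i : 'I_n, forall j : 'I_n, forall k : 'I_n,
    (i < j)%N && (j < k)%N ==>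
    [forall a in subdiagram w i j k, hook_balanced (subdiagram w i j k) T a]].
End Labellings.

(* Main.v *)
Require Import Defs.
From mathcomp Require Import all_boot all_order all_algebra all_fingroup.
From mathcomp Require Import ring zify.
From mathcomp.multinomials Require Import mpoly.

Set Implicit Arguments.
Unset Strict Implicit.
Unset Printing Implicit Defensive.

Import GRing.Theory.
Local Open Scope ring_scope.

(** Both sides of the identity are coefficients of the Fomin-Kirillov product
    of 0-Hecke factors: with the generators u_a normalized by u_a ^ 2 = - u_a,
    it is the product, over the variables x_t in increasing order of t and, for
    each t, over the letters a >= t in decreasing order, of the factors
    1 + x_t u_a.

    On the side of Grothendieck polynomials, the recursion G_(w s_i) = pi_i G_w
    is a symmetry.  The rows (1 + x u_(m-1)) ... (1 + x u_a) for two values of x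
    commute (hecke_rowC), by the Yang-Baxter equation (hecke_exchange).  Hence
    one more factor 1 + x_(i+1) u_i makes the product symmetric in x_i and
    x_(i+1) (msym_product_above), and comparing the coefficients of w and w s_i
    in that symmetric expression gives the divided difference
    (hecke_product_isobaric).

    On the side of labellings, a label is the time at which an inversion is
    created, or met again without effect, while the factors are multiplied one
    by one.  Indexing labels by the pair of values that they exchange makes the
    labelling independent of the order of the entries of w; balancedness then
    says, for each triple of values, that the three pairs are exchanged at times
    at which they may be adjacent (subdiagram_balancedP, diagram_labellingP).
    The factors are peeled off from the last one: in a balanced labelling whose
    largest label t is confined to rows at least i, the factor 1 + x_t u_i is
    used exactly when t occurs in row i, and then t labels the pair of values
    in positions i and i + 1 (label_corner); removing it leaves a balanced
    labelling of w s_i or of w, according to whether it was the only label of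
    that pair (valid_add).  So the generating function of labellings satisfies
    the recursion of the product (valid_sum_step).

    Both sides agree at the longest permutation, which has a single labelling
    (valid_sum_w0), and the isobaric recursion determines the rest. *)

(** * Factors of the 0-Hecke product *)

Section HeckeFactors.
Variables (R : idomainType) (n : nat).
Implicit Types (f : {ffun 'S_n -> R}) (w : 'S_n) (i j k l : 'I_n) (x y : R).

(** Multiplication by 1 + x u_ij on a formal sum of permutations, f w being the
    coefficient of w.  The generators are signed so that u_ij ^ 2 = - u_ij:
    for a descent w of (i, j), the coefficient of w receives f (w s_ij), from
    the step that creates the inversion, and - f w, from the step that finds it
    already there. *)
Definition hecke_factor i j x f : {ffun 'S_n -> R} :=
  [ffun w : 'S_n => f w + (if (w j < w i)%N
                           then x * (f (tperm i j * w)%g - f w) else 0)].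

(** The inverse of 1 + x u_ij is 1 - x / (1 - x) u_ij; the factor 1 - x clears
    the denominator. *)
Definition hecke_cofactor i j x f : {ffun 'S_n -> R} :=
  [ffun w : 'S_n => (1 - x) * f w - (if (w j < w i)%N
                           then x * (f (tperm i j * w)%g - f w) else 0)].

Lemma hecke_cofactorK i j x f w :
  hecke_cofactor i j x (hecke_factor i j x f) w = (1 - x) * f w.
Proof.
rewrite !ffunE !permM tpermL tpermR.
by case: (ltngtP (w j) (w i)) => wij; ring.
Qed.

Lemma hecke_factor_cohom i j x f (c : R) :
  hecke_factor i j x [ffun w => c * f w] = [ffun w => c * hecke_factor i j x f w].
Proof. by apply/ffunP => w; rewrite !ffunE; case: ifP => _; ring. Qed.

Lemma hecke_factorC i j x y f :
  hecke_factor i j x (hecke_factor i j y f)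
  = hecke_factor i j y (hecke_factor i j x f).
Proof.
apply/ffunP => w; rewrite !ffunE !permM tpermL tpermR.
by case: (ltngtP (w j) (w i)) => wij; ring.
Qed.

Lemma hecke_factor_far i j k l x y f :
  i != j -> k != l -> i != k -> i != l -> j != k -> j != l ->
  hecke_factor i j x (hecke_factor k l y f)
  = hecke_factor k l y (hecke_factor i j x f).
Proof.
move=> ij kl ik il jk jl.
have st w : (tperm k l * (tperm i j * w) = tperm i j * (tperm k l * w))%g.
  apply/permP => z; rewrite !permM.
  case: (tpermP k l z) => [->|->|zk zl].
  - by rewrite ![tperm i j _]tpermD // tpermL.
  - by rewrite ![tperm i j _]tpermD // tpermR.
  - case: (tpermP i j z) => [_|_|_ _]; rewrite tpermD //;
      by [rewrite eq_sym|apply/eqP => e; by [case: zk|case: zl]].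
apply/ffunP => w; rewrite !ffunE !permM.
have -> : tperm i j k = k by rewrite tpermD.
have -> : tperm i j l = l by rewrite tpermD.
have -> : tperm k l i = i by rewrite tpermD // eq_sym.
have -> : tperm k l j = j by rewrite tpermD // eq_sym.
rewrite st.
by case: (w j < w i)%N; case: (w l < w k)%N; ring.
Qed.

(** The Yang-Baxter equation of the 0-Hecke algebra, in the form that makes
    products of factors symmetric: up to the normalization of the cofactors,
    (1 + x u_i)(1 + x u_j)(1 + y u_i)(1 + x u_j)^-1 is symmetric in x and y.
    Only w i, w j, w k matter, and each of their six relative orders leaves a
    polynomial identity. *)
Lemma hecke_exchange i j k x y f w :
  i != j -> j != k -> i != k ->
  (1 - y) * hecke_factor i j x (hecke_factor j k x
              (hecke_factor i j y (hecke_cofactor j k x f))) w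
  = (1 - x) * hecke_factor i j y (hecke_factor j k y
              (hecke_factor i j x (hecke_cofactor j k y f))) w.
Proof.
move=> ij jk ik.
have sk : tperm i j k = k by rewrite tpermD.
have ti : tperm j k i = i by rewrite tpermD // eq_sym.
have ss v : (tperm i j * (tperm i j * v) = v)%g by rewrite mulgA tperm2 mul1g.
have tt v : (tperm j k * (tperm j k * v) = v)%g by rewrite mulgA tperm2 mul1g.
have sts v : (tperm j k * (tperm i j * (tperm j k * v))
             = tperm i j * (tperm j k * (tperm i j * v)))%g.
  by have := tperm_braid ij jk ik; rewrite !mulgA => ->.
rewrite !ffunE !permM !(tpermL, tpermR, sk, ti) !(ss, tt, sts).
have neq a b : a != b -> w a != w b by rewrite (inj_eq perm_inj).
have := (neq _ _ ij, neq _ _ jk, neq _ _ ik); rewrite -!val_eqE /=.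
move: (w i : nat) (w j : nat) (w k : nat) => a b c [[ab bc] ac].
case: (ltngtP b a) ab => // ab _; case: (ltngtP c b) bc => // bc _;
 case: (ltngtP c a) ac => // ac _; try lia; ring.
Qed.
End HeckeFactors.

(** * Rows of factors and divided differences *)

Section HeckeRows.
Variables (R : idomainType) (m : nat).
Implicit Types (f g : {ffun 'S_m.+1 -> R}) (w : 'S_m.+1) (x y : R) (a b c : nat).

Local Notation h c := (@hecke_factor R m.+1 (inord c) (inord c.+1)).

(** The operator (1 + x u_a)(1 + x u_(a+1)) ... (1 + x u_(m-1)), whose innermost
    factor is applied first: it is the right multiplication by the generating
    function of the decreasing words with letters at least a. *)
Definition hecke_row a x f := foldr (fun c => h c x) f (iota a (m - a)).

Lemma hecke_row_last a x f : (m <= a)%N -> hecke_row a x f = f.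
Proof. by rewrite /hecke_row -subn_eq0 => /eqP ->. Qed.

Lemma hecke_rowS a x f : (a < m)%N ->
  hecke_row a x f = h a x (hecke_row a.+1 x f).
Proof. by move=> am; rewrite /hecke_row -(subnSK am). Qed.

Lemma inord_neq a b : (a <= m)%N -> (b <= m)%N -> a != b ->
  inord a != inord b :> 'I_m.+1.
Proof. by move=> am bm; rewrite -val_eqE /= !inordK. Qed.

Lemma hecke_row_far a b x y f : (a.+1 < b)%N ->
  h a x (hecke_row b y f) = hecke_row b y (h a x f).
Proof.
have [k] := ubnP (m - b); elim: k b => // k IH b kb ab.
case: (leqP m b) => bm; first by rewrite !hecke_row_last.
rewrite ![hecke_row b _ _]hecke_rowS // -IH; [|lia..].
by apply: hecke_factor_far; apply: inord_neq; lia.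
Qed.

(** Peeling the factors of index a off both rows leaves a product which is
    symmetric by induction, multiplied by the symmetric expression of
    hecke_exchange. *)
Lemma hecke_rowC a x y f : 1 - x != 0 -> 1 - y != 0 ->
  hecke_row a x (hecke_row a y f) = hecke_row a y (hecke_row a x f).
Proof.
move=> x1 y1; have [k] := ubnP (m - a).
elim: k a => // k IH a ka.
case: (leqP m a) => am; first by rewrite !hecke_row_last.
case: (leqP m a.+1) => bm.
  by rewrite ![hecke_row a _ _]hecke_rowS // !hecke_row_last // hecke_factorC.
have E z t w :
    (1 - z) * hecke_row a z (hecke_row a t f) w
    = h a z (h a.+1 z (h a t (hecke_cofactor (inord a.+1) (inord a.+2) z
        (hecke_row a.+1 z (hecke_row a.+1 t f))))) w.
  rewrite [hecke_row a z _]hecke_rowS // [hecke_row a t _]hecke_rowS //.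
  rewrite [hecke_row a.+1 z (h a _ _)]hecke_rowS // -hecke_row_far //.
  rewrite [hecke_row a.+1 z (hecke_row _ _ _)]hecke_rowS //.
  have -> g : hecke_cofactor (inord a.+1) (inord a.+2) z (h a.+1 z g)
              = [ffun w => (1 - z) * g w].
    by apply/ffunP => v; rewrite hecke_cofactorK ffunE.
  by rewrite !hecke_factor_cohom [in RHS]ffunE.
apply/ffunP => w; apply: (mulfI (mulf_neq0 x1 y1)).
rewrite -[RHS]mulrA (E y x w) [in LHS](mulrC (1 - x)) -[LHS]mulrA (E x y w).
have -> : hecke_row a.+1 y (hecke_row a.+1 x f)
          = hecke_row a.+1 x (hecke_row a.+1 y f) by apply: esym; apply: IH; lia.
by apply: hecke_exchange; apply: inord_neq; lia.
Qed.

End HeckeRows.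

Section HeckeProduct.
Variable m : nat.
Implicit Types (f g : {ffun 'S_m.+1 -> {mpoly int[m.+1]}}) (w : 'S_m.+1).

Local Notation X t := ('X_(inord t) : {mpoly int[m.+1]}).

(** The first t rows of the Fomin-Kirillov product, applied to the identity
    permutation; row t' uses the variable of index t'. *)
Fixpoint hecke_product t : {ffun 'S_m.+1 -> {mpoly int[m.+1]}} :=
  if t isn't t'.+1 then [ffun w => (w == 1%g)%:R]
  else hecke_row t' (X t') (hecke_product t').

Definition msym_ffun s f : {ffun 'S_m.+1 -> {mpoly int[m.+1]}} :=
  [ffun w : 'S_m.+1 => msym s (f w)].

Lemma msym_hecke_factor s i j x f :
  msym_ffun s (hecke_factor i j x f) = hecke_factor i j (msym s x) (msym_ffun s f).
Proof.
apply/ffunP => w; rewrite !ffunE msymD; congr (_ + _).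
by case: ifP => _; rewrite ?msym0 // msymM msymB.
Qed.

Lemma msym_hecke_row s a x f :
  msym_ffun s (hecke_row a x f) = hecke_row a (msym s x) (msym_ffun s f).
Proof.
rewrite /hecke_row; elim: (iota _ _) => //= c l IH.
by rewrite msym_hecke_factor IH.
Qed.

Lemma subr1X_neq0 t : 1 - X t != 0.
Proof.
rewrite subr_eq0; apply/negP => /eqP/(congr1 (mcoeff U_(inord t)%MM)).
rewrite mcoeffX eqxx mcoeff1; case: eqP => // /mnmP/(_ (inord t)).
by rewrite mnm1E eqxx mnm0E.
Qed.

Section Symmetry.
Variables (i : nat) (im : (i < m)%N).
Let s := tperm (inord i) (inord i.+1) : 'S_m.+1.

Lemma msym_X_other t : (t <= m)%N -> t != i -> t != i.+1 -> msym s (X t) = X t.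
Proof.
by move=> tm ti ti'; rewrite msymXU tpermD //; apply: inord_neq;
   rewrite // 1?eq_sym // ltnW.
Qed.

Lemma msym_product_below t : (t <= i)%N -> 
  msym_ffun s (hecke_product t) = hecke_product t.
Proof.
elim: t => [|t IH] ti /=.
  by apply/ffunP => w; rewrite !ffunE; case: (w == _); rewrite ?msym1 ?msym0.
by rewrite msym_hecke_row IH ?msym_X_other //; lia.
Qed.

(** One more factor in the variable of index i + 1 completes row i + 1 to a
    second row i, and the two rows i commute; the later rows have indices too
    large to interfere. *)
Lemma msym_product_above t : (i.+1 < t <= m.+1)%N ->
  let g := hecke_factor (inord i) (inord i.+1) (X i.+1) (hecke_product t) in
  msym_ffun s g = g.
Proof.
move=> /= /andP[].
have := leqnn t; move: {-2}t; elim: t => [|t IH] t'; first by case: t'.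
rewrite leq_eqVlt => /predU1P[->|]; last by rewrite ltnS; apply: IH.
rewrite leq_eqVlt => /predU1P[[<-]|].
  move=> _; rewrite /= -hecke_rowS // !msym_hecke_row msym_product_below //.
  by rewrite !msymXU tpermL tpermR hecke_rowC // subr1X_neq0.
rewrite ltnS => it tm /=.
by rewrite hecke_row_far // msym_hecke_row IH ?msym_X_other //; lia.
Qed.

End Symmetry.

(** At w, which has an ascent at (i, j), the symmetric function of
    msym_product_above is the coefficient p of w; at w s_i it is
    (1 - x_j) q + x_j p, where q is the coefficient of w s_i.  Its invariance
    under the exchange of x_i and x_j is the equation defining p as the
    isobaric divided difference of q. *)
Lemma hecke_product_isobaric (i j : 'I_m.+1) w : ascent w i j ->
  hecke_product m.+1 w = isobaric i j (hecke_product m.+1 (tperm i j * w)%g).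
Proof.
move=> asc; have nij := ascent_neq asc.
case/andP: asc => /eqP ij wij.
have im : (i < m)%N by have := ltn_ord j; rewrite ij.
have nz : 'X_i - 'X_j != 0 :> {mpoly int[m.+1]}.
  by rewrite subr_eq0 mpolyXU_neq.
have Ei : inord i = i by rewrite inord_val.
have Ej : inord i.+1 = j by rewrite -ij inord_val.
apply: (mulfI nz); rewrite isobaricE.
have := @msym_product_above i im m.+1 _ => /(_ _)/ffunP S.
rewrite Ei Ej ltnS im leqnn in S.
have := S isT w; have := S isT (tperm i j * w)%g.
rewrite !ffunE !permM tpermL tpermR mulgA tperm2 mul1g wij.
rewrite ltnNge ltnW //= !addr0.
move: (hecke_product m.+1 w) (hecke_product m.+1 _) => p q.
rewrite msymD msymM msymB msymXU tpermR => E1 E2; rewrite E2 in E1.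
apply/eqP; rewrite -subr_eq0; apply/eqP; rewrite -[RHS](subrr (q + 'X_j * (p - q))).
by rewrite -{1}E1; ring.
Qed.

End HeckeProduct.

(** * Balancedness of three label sets *)

Section Triples.
Variable n : nat.
Implicit Types (X Y Z A : {set 'I_n}) (x y z s t : 'I_n).

Lemma leq_min_label k A : (k <= n)%N ->
  (k <= min_label A)%N = [forall t in A, (k <= t)%N].
Proof.
move=> kn; rewrite /min_label (big_morph (leq k) (leq_min k) kn).
by rewrite big_andE.
Qed.

Lemma min_label_leqn A : (min_label A <= n)%N.
Proof.
rewrite /min_label; elim/big_ind: _ => // [a b an bn|t _]; last exact: ltnW.
by rewrite geq_min an.
Qed.

Lemma min_label_leq A t : t \in A -> (min_label A <= t)%N.
Proof.
move=> tA; have := leq_min_label A (min_label_leqn A).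
by rewrite leqnn => /esym/forall_inP; apply.
Qed.

Variant min_label_spec A : nat -> Prop :=
  | MinLabelNone of A = set0 : min_label_spec A n
  | MinLabelSome m of m \in A & {in A, forall s : 'I_n, (m <= s)%N} :
      min_label_spec A m.

Lemma min_labelP A : min_label_spec A (min_label A).
Proof.
have [->|/set0Pn[t tA]] := eqVneq A set0.
  by rewrite /min_label big_set0; apply: MinLabelNone.
case: (arg_minnP (fun s : 'I_n => val s) tA) => m mA mm.
have -> : min_label A = m; last by apply: MinLabelSome.
apply/eqP; rewrite eqn_leq min_label_leq // leq_min_label; last exact: ltnW.
by apply/forall_inP => s; apply: mm.
Qed.

Lemma min_label0 : min_label (set0 : {set 'I_n}) = n.
Proof. by rewrite /min_label big_set0. Qed.

Lemma min_label_setU1 t A : {in A, forall s : 'I_n, (s <= t)%N} -> A != set0 ->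
  min_label (t |: A) = min_label A.
Proof.
move=> At; case: (min_labelP A) => [->|m mA mm _]; first by rewrite eqxx.
apply/eqP; rewrite eqn_leq min_label_leq ?in_setU1 ?mA ?orbT //.
rewrite leq_min_label; last exact: ltnW.
apply/forall_inP => s; rewrite in_setU1 => /orP[/eqP->|/mm//]; exact: At.
Qed.

Lemma min_label_set1 t : min_label [set t] = t.
Proof.
apply/eqP; rewrite eqn_leq min_label_leq ?inE // leq_min_label; last exact: ltnW.
by apply/forall_inP => s; rewrite inE => /eqP ->.
Qed.

(** For values p < q < r with label sets X, Y, Z on the pairs (p, q), (q, r),
    (p, r), read labels as the times at which the two values are exchanged, or
    exchanged again to no effect.  From p q r one reaches r q p by exchanging
    the pairs in the order Y, Z, X or X, Z, Y; the pair (p, r) is adjacent only in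
    between: after the exchanges of the first pair that precede all exchanges of
    the third one, and not later than the latter.  An empty set has infinite minimum and stands for
    a pair that is never exchanged. *)
Definition between X Y Z : bool :=
  [forall z in Z,
    if (min_label Y < min_label X)%N
    then (z <= min_label X)%N &&
         [forall y in Y, (y < min_label X)%N ==> (y <= z)%N]
    else (z <= min_label Y)%N &&
         [forall x in X, (x <= min_label Y)%N ==> (x <= z)%N]].

Definition triple_ok X Y Z : bool := [disjoint X & Z] && between X Y Z.

Lemma betweenP X Y Z : reflect
  (forall z, z \in Z ->
    if (min_label Y < min_label X)%N
    then (z <= min_label X)%N /\
         (forall y, y \in Y -> (y < min_label X)%N -> (y <= z)%N)
    else (z <= min_label Y)%N /\
         (forall x, x \in X -> (x <= min_label Y)%N -> (x <= z)%N))
  (between X Y Z).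
Proof.
apply: (iffP forall_inP) => H z /H; case: ifP => _.
- by case/andP=> -> /forall_inP h; split=> // y /h/implyP.
- by case/andP=> -> /forall_inP h; split=> // y /h/implyP.
- by case=> -> h; apply/forall_inP => y yY; apply/implyP; apply: h.
- by case=> -> h; apply/forall_inP => y yY; apply/implyP; apply: h.
Qed.

Lemma between_set0 X Y : between X Y set0.
Proof. by apply/betweenP => z; rewrite inE. Qed.

Lemma triple_ok_set0 X Y : triple_ok X Y set0.
Proof. by rewrite /triple_ok between_set0 disjoint_sym disjoints_subset sub0set. Qed.

Lemma betweenX0P Y Z : reflect {in Y & Z, forall y z, (y <= z)%N}
                              (between set0 Y Z).
Proof.
apply: (iffP (betweenP _ _ _)); rewrite min_label0 => H.
  move=> y z yY /H; rewrite (leq_ltn_trans (min_label_leq yY)) //.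
  by case=> _; apply.
move=> z zZ; case: ifP => [_|]; first by split=> [|y yY _]; [exact: ltnW|apply: H].
case: (min_labelP Y) => [_ _|m _ _]; last by rewrite ltn_ord.
by split=> [|x]; [exact: ltnW|rewrite inE].
Qed.

Lemma betweenY0P X Z : reflect {in X & Z, forall x z, (x <= z)%N}
                              (between X set0 Z).
Proof.
apply: (iffP (betweenP _ _ _)); rewrite min_label0 ltnNge min_label_leqn /= => H.
  by move=> x z xX /H[_]; apply=> //; exact: ltnW.
by move=> z zZ; split=> [|x xX _]; [exact: ltnW|apply: H].
Qed.

Lemma disjoint_neq X Z x z : [disjoint X & Z] -> x \in X -> z \in Z -> x != z :> nat.
Proof.
rewrite disjoints_subset => /subsetP H /H; rewrite inE => xZ zZ.
by apply: contraNneq xZ => /val_inj ->.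
Qed.

Lemma disjoint_neqP X Z : {in X & Z, forall x z, x != z :> nat} -> [disjoint X & Z].
Proof.
move=> H; rewrite disjoints_subset; apply/subsetP => x xX; rewrite inE.
by apply/negP => /(H _ _ xX); rewrite eqxx.
Qed.

Lemma triple_okX0 Y Z : triple_ok set0 Y Z = between set0 Y Z.
Proof. by rewrite /triple_ok disjoints_subset sub0set. Qed.

Lemma triple_okY0P X Z : reflect {in X & Z, forall x z, (x < z)%N}
                                 (triple_ok X set0 Z).
Proof.
apply: (iffP andP) => [[d /betweenY0P H] x z xX zZ|H].
  by rewrite ltn_neqAle (disjoint_neq d) ?H.
split; last by apply/betweenY0P => x z xX zZ; apply: ltnW; apply: H.
by apply: disjoint_neqP => x z xX zZ; rewrite neq_ltn H.
Qed.

(** When t is at least every label present, adding it to one of the three sets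
    does not affect the condition, provided that the pair that receives it is
    adjacent at that moment; which of the lemmas below applies depends on
    the pair and on the position of the third value. *)
Section Bounded.
Variables (X Y Z : {set 'I_n}) (t : 'I_n).

Lemma triple_ok_addX : {in X, forall x : 'I_n, (x <= t)%N} ->
  {in Y, forall y : 'I_n, (y < t)%N} -> {in Z, forall z : 'I_n, (z < t)%N} ->
  Y != set0 -> triple_ok (t |: X) Y Z = triple_ok X Y Z.
Proof.
move=> Xt Yt Zt Y0; congr (_ && _).
  rewrite !disjoints_subset subUset sub1set inE.
  by case: (boolP (t \in Z)) => // /Zt; rewrite ltnn.
have Ym : (min_label Y < t)%N.
  by case: (min_labelP Y) Y0 => [->|m /Yt //]; rewrite eqxx.
have [X0|X0] := eqVneq X set0.
  rewrite X0 setU0; apply/betweenP/betweenX0P => [H y z yY zZ|H z zZ].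
    have := H z zZ; rewrite min_label_set1 Ym => -[_]; apply=> //; exact: Yt.
  rewrite min_label_set1 Ym; split=> [|y yY _]; first exact/ltnW/Zt.
  exact: H.
rewrite /between min_label_setU1 //.
apply: eq_forallb_in => z zZ; case: ifP => // _; congr (_ && _).
apply/forall_inP/forall_inP => H x; first by move=> xX; apply: H; rewrite inE xX orbT.
by rewrite in_setU1 => /predU1P[->|/H//]; rewrite leqNgt Ym.
Qed.

Lemma triple_ok_addY : {in X, forall x : 'I_n, (x <= t)%N} ->
  {in Y, forall y : 'I_n, (y <= t)%N} -> {in Z, forall z : 'I_n, (z <= t)%N} ->
  X != set0 -> Z != set0 -> triple_ok X (t |: Y) Z = triple_ok X Y Z.
Proof.
move=> Xt Yt Zt X0 /set0Pn[z0 z0Z].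
have Xm : (min_label X <= t)%N.
  by case: (min_labelP X) X0 => [->|m /Xt //]; rewrite eqxx.
have [Y0|Y0] := eqVneq Y set0.
  rewrite Y0 setU0; apply/andP/triple_okY0P => [[d /betweenP H] x z xX zZ|H].
    move: (H z zZ); rewrite min_label_set1 ltnNge Xm => -[_ /(_ x xX (Xt _ xX)) xz].
    by rewrite ltn_neqAle (disjoint_neq d).
  split; first by apply: disjoint_neqP => x z xX zZ; rewrite neq_ltn H.
  apply/betweenP => z zZ; rewrite min_label_set1 ltnNge Xm; split; first exact: Zt.
  by move=> x xX _; apply: ltnW; apply: H.
rewrite /triple_ok /between min_label_setU1 //; congr (_ && _).
apply: eq_forallb_in => z zZ; case: ifP => // _; congr (_ && _).
apply/forall_inP/forall_inP => H x; first by move=> xX; apply: H; rewrite inE xX orbT.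
by rewrite in_setU1 => /predU1P[->|/H//]; rewrite ltnNge Xm.
Qed.

Lemma triple_ok_addZ_X0 : {in Y, forall y : 'I_n, (y <= t)%N} ->
  triple_ok set0 Y (t |: Z) = triple_ok set0 Y Z.
Proof.
move=> Yt; rewrite !triple_okX0; apply/betweenX0P/betweenX0P => H y z yY zZ.
  by apply: H => //; rewrite inE zZ orbT.
by move: zZ; rewrite in_setU1 => /predU1P[->|/H]; [apply: Yt|apply].
Qed.

Lemma triple_ok_addZ_Y0 : {in X, forall x : 'I_n, (x < t)%N} ->
  triple_ok X set0 (t |: Z) = triple_ok X set0 Z.
Proof.
move=> Xt; apply/triple_okY0P/triple_okY0P => H y z yY zZ.
  by apply: H => //; rewrite inE zZ orbT.
by move: zZ; rewrite in_setU1 => /predU1P[->|/H]; [apply: Xt|apply].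
Qed.

Lemma triple_ok_notinZ : {in X, forall x : 'I_n, (x <= t)%N} ->
  {in Y, forall y : 'I_n, (y <= t)%N} -> X != set0 -> Y != set0 -> t \notin Y ->
  triple_ok X Y Z -> t \notin Z.
Proof.
move=> Xt Yt X0 Y0 tY /andP[d /betweenP H]; apply/negP => tZ.
have := H t tZ; move: X0 Y0 tY.
case: (min_labelP X) => [->|x xX _ _]; first by rewrite eqxx.
case: (min_labelP Y) => [->|y yY _ _ tY]; first by rewrite eqxx.
have := disjoint_neq d xX tZ; have := Xt _ xX; have := Yt _ yY.
have : y != t :> nat by apply: contraNneq tY => /val_inj <-.
by case: ifP => _ ? ? ? []; lia.
Qed.
End Bounded.
End Triples.

(** * Labellings indexed by pairs of values *)

Section Valid.
Variable n : nat.
Implicit Types (w : 'S_n) (L : labelling n) (u v p q r s t i j : 'I_n).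
Implicit Types (P : rel nat) (a : nat) (A : {set 'I_n}).

Definition inverted w u v : bool := (u < v)%N && ((w^-1)%g v < (w^-1)%g u)%N.

(** Labellings are indexed here by pairs of values u < v instead of boxes: the
    box of the pair is in column u and in the row where v stands.  Exchanging
    two adjacent entries of w then moves no label.  The relation P, between a
    label and the row of its box, generalizes the flag condition. *)
Definition valid P w L : bool :=
  [&& [forall u : 'I_n, forall v : 'I_n, (L (u, v) != set0) == inverted w u v],
      [forall p : 'I_n, forall q : 'I_n, forall r : 'I_n, (p < q)%N && (q < r)%N ==>
         triple_ok (L (p, q)) (L (q, r)) (L (p, r))]
    & [forall u : 'I_n, forall v : 'I_n, forall s in L (u, v), P s ((w^-1)%g v)]].

Lemma validP P w L : reflect
  [/\ forall u v, (L (u, v) != set0) = inverted w u v,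
      forall p q r, (p < q)%N -> (q < r)%N ->
         triple_ok (L (p, q)) (L (q, r)) (L (p, r))
    & forall u v s, s \in L (u, v) -> P s ((w^-1)%g v)]
  (valid P w L).
Proof.
apply: (iffP and3P) => -[H1 H2 H3]; split.
- by move=> u v; move/forallP/(_ u)/forallP/(_ v)/eqP: H1.
- move=> p q r pq qr; move/forallP/(_ p)/forallP/(_ q)/forallP/(_ r): H2.
  by rewrite pq qr.
- by move=> u v; move/forallP/(_ u)/forallP/(_ v)/forall_inP: H3; apply.
- by apply/forallP => u; apply/forallP => v; rewrite H1.
- apply/forallP => p; apply/forallP => q; apply/forallP => r.
  by apply/implyP => /andP[]; apply: H2.
- apply/forallP => u; apply/forallP => v; apply/forall_inP; exact: H3.
Qed.

(** Each box contributes |A| to the number of labels and 1 to the length, so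
    the global sign is the product of these local ones; for a pair outside the
    diagram the weight is 1, because 0.-1 = 0. *)
Definition weight (A : {set 'I_n}) : {mpoly int[n]} :=
  (-1) ^+ (#|A|.-1) * \prod_(t in A) 'X_t.

Definition valid_sum P w : {mpoly int[n]} :=
  \sum_(L : labelling n | valid P w L) \prod_e weight (L e).

(** The rows permitted to the labels when the variables of index below t have
    been used completely, and that of index t with the factors u_a, u_(a+1), ...
    only: the larger of two values exchanged at time t is then in row a or below. *)
Definition stage (t a : nat) : rel nat :=
  fun s r : nat => (s <= r)%N && ((s < t)%N || (s == t :> nat) && (a <= r)%N).

Definition add_label t (e : 'I_n * 'I_n) L : labelling n :=
  [ffun x => if x == e then t |: L x else L x].
Definition del_label t (e : 'I_n * 'I_n) L : labelling n :=
  [ffun x => if x == e then L x :\ t else L x].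

Lemma add_labelK t e L : t \notin L e -> del_label t e (add_label t e L) = L.
Proof.
move=> tL; apply/ffunP => x; rewrite !ffunE; case: eqP => // ->.
by rewrite setU1K.
Qed.

Lemma del_labelK t e L : t \in L e -> add_label t e (del_label t e L) = L.
Proof.
move=> tL; apply/ffunP => x; rewrite !ffunE; case: eqP => // ->.
by rewrite setD1K.
Qed.

Lemma weight_add t A : t \notin A ->
  weight (t |: A) = 'X_t * (if A == set0 then weight A else - weight A).
Proof.
move=> tA; rewrite /weight cardsU1 tA big_setU1 //=.
have [->|/set0Pn[x xA]] := eqVneq A set0.
  by rewrite cards0 expr0 !mul1r.
have : (0 < #|A|)%N by apply/card_gt0P; exists x.
by case: #|A| => // k _; rewrite /= exprS; ring.
Qed.

Lemma prod_weight_add t e L : t \notin L e ->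
  \prod_x weight (add_label t e L x) =
  'X_t * (if L e == set0 then \prod_x weight (L x) else - \prod_x weight (L x)).
Proof.
move=> tL; rewrite (bigD1 e) //= [in RHS](bigD1 e) //= ffunE eqxx weight_add //.
under eq_bigr => x /negPf xe do rewrite ffunE xe.
by case: eqP => _; ring.
Qed.

(** The effect of the factor 1 + x_t u_i: at stage (t, i), the label t occurs in
    row i if and only if that factor is used, and it then belongs to the pair e
    of the values in positions i and j = i + 1. *)
Section Step.
Variables (t i j : 'I_n) (ij : j = i.+1 :> nat) (ti : (t <= i)%N) (w : 'S_n).
Let e := (w j, w i).
Let sw := (tperm i j * w)%g.
Local Notation pos := (w^-1)%g.

Lemma pos_swap v : (sw^-1)%g v = tperm i j (pos v).
Proof. by rewrite invMg permM tpermV. Qed.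

Lemma pos_neq u v : u != v -> pos u != pos v :> nat.
Proof. by apply: contraNneq => /val_inj/perm_inj ->. Qed.

Lemma pos_wi : pos (w i) = i. Proof. by rewrite permK. Qed.
Lemma pos_wj : pos (w j) = j. Proof. by rewrite permK. Qed.

(** If the pair e lacked t, the triple formed by u and the two values of e would
    be unbalanced: t is the largest label, and the value w j stands between
    w i and u. *)
Lemma label_corner L u : valid (stage t i) w L -> t \in L (u, w i) -> t \in L e.
Proof.
case/validP => Hs Ht Hr tL; apply/negPn/negP => tNe.
have bound x y s : s \in L (x, y) -> (s <= t)%N.
  by case/Hr/andP => _ /orP[/ltnW//|/andP[/eqP-> _]].
have ue : u != w j by apply: contraNneq tNe => E; rewrite /e -E.
have: inverted w u (w i) by rewrite -Hs; apply/set0Pn; exists t.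
case/andP => uv; rewrite pos_wi => pu.
have pju : (j < pos u)%N.
  by have := pos_neq ue; rewrite pos_wj ij; lia.
have L0 x y : inverted w x y = false -> L (x, y) = set0.
  by move=> f; apply/eqP; rewrite -[_ == _]negbK Hs f.
have wij : w i != w j :> nat.
  by apply/eqP => /val_inj/perm_inj E; move: ij; rewrite E; lia.
have [wlt|wge] := ltnP (w i) (w j).
  have Y0 : L (w i, w j) = set0.
    by apply: L0; rewrite /inverted pos_wi pos_wj ij; lia.
  have /set0Pn[z zL] : L (u, w j) != set0.
    by rewrite Hs /inverted pos_wj pju andbT; lia.
  have := Ht u (w i) (w j) uv wlt; rewrite Y0 => /triple_okY0P/(_ t z tL zL).
  by rewrite ltnNge (bound _ _ _ zL).
have [ult|uge] := ltnP u (w j).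
  have := Ht u (w j) (w i) ult; rewrite ltn_neqAle eq_sym wij wge => /(_ isT).
  have X0 : L (u, w j) != set0 by rewrite Hs /inverted pos_wj ult.
  have Y0 : L (w j, w i) != set0.
    by rewrite Hs /inverted pos_wj pos_wi ij ltnSn andbT; lia.
  by move/(triple_ok_notinZ (bound _ _) (bound _ _) X0 Y0 tNe); rewrite tL.
have lt : (w j < u)%N.
  by rewrite ltn_neqAle uge andbT eq_sym (inj_eq val_inj).
have X0 : L (w j, u) = set0.
  by apply: L0; rewrite /inverted pos_wj; lia.
have /set0Pn[z zL] : L (w j, w i) != set0.
  by rewrite Hs /inverted pos_wj pos_wi ij ltnSn andbT; lia.
have := Ht _ _ _ lt uv; rewrite X0 triple_okX0 => /betweenX0P/(_ t z tL zL).
move=> tz; have zt : z = t by apply/val_inj/eqP; rewrite /= eqn_leq tz (bound _ _ _ zL).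
by move: tNe; rewrite /e -zt zL.
Qed.

Lemma valid_unused L :
  valid (stage t i) w L && (t \notin L e) = valid (stage t j) w L.
Proof.
apply/andP/idP => [[V tL]|V].
  case/validP: (V) => Hs Ht Hr; apply/validP; split=> // u v s sL.
  have := Hr _ _ _ sL; rewrite /stage => /andP[-> /=].
  case/orP => [->//|/andP[/eqP/val_inj st iv]]; rewrite st eqxx /=.
  apply/orP; right; rewrite ij ltn_neqAle iv andbT.
  apply: contraNneq tL => iv'; apply: (@label_corner L u) => //.
  by rewrite -st (_ : w i = v) // (val_inj iv') permKV.
case/validP: (V) => Hs Ht Hr; split.
  apply/validP; split=> // u v s /Hr; rewrite /stage => /andP[-> /=].
  case/orP => [->//|/andP[-> jv]]; apply/orP; right.
  by rewrite /=; move: jv; rewrite ij; lia.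
apply/negP => /Hr; rewrite /stage pos_wi ij; lia.
Qed.

Hypothesis wij : (w j < w i)%N.

Lemma inverted_swap u v : (u, v) != e -> inverted sw u v = inverted w u v.
Proof.
rewrite -(permKV w u) -(permKV w v); move: (pos u) (pos v) => a b ne.
rewrite /inverted !pos_swap !permK; case: ltnP => //= ab.
move: ne ab; rewrite xpair_eqE !(inj_eq perm_inj) -!val_eqE /= => ne ab.
move: wij ij ne ab.
have neN (c d : 'I_n) : c <> d -> c <> d :> nat by move=> h /val_inj.
by case: (tpermP i j a) => [->|->|/neN ai /neN aj];
  case: (tpermP i j b) => [->|->|/neN bi /neN bj]; rewrite ?eqxx /=; lia.
Qed.

(** Only triples containing both values of e are affected.  If the third value
    stands left of position i, the labels in its row are less than t. *)
Lemma triple_ok_add L p q r :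
  (forall u v, (add_label t e L (u, v) != set0) = inverted w u v) ->
  (forall u v s, s \in L (u, v) -> (s <= t)%N /\ (s = t -> (i <= pos v)%N)) ->
  (p < q)%N -> (q < r)%N ->
  let T := add_label t e L in
  triple_ok (T (p, q)) (T (q, r)) (T (p, r))
  = triple_ok (L (p, q)) (L (q, r)) (L (p, r)).
Proof.
move=> Hs Hb pq qr /=.
have bound x y : {in L (x, y), forall s : 'I_n, (s <= t)%N}.
  by move=> s /Hb[].
have sbound x y : (pos y < i)%N -> {in L (x, y), forall s : 'I_n, (s < t)%N}.
  move=> yi s /Hb[st sti]; rewrite ltn_neqAle st andbT.
  by apply/negP => /eqP/val_inj/sti; rewrite leqNgt yi.
have Te x : x != e -> add_label t e L x = L x.
  by rewrite ffunE => /negPf ->.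
have Tee : add_label t e L e = t |: L e by rewrite ffunE eqxx.
have H0 x : x != e -> (L x != set0) = inverted w x.1 x.2.
  by move=> xe; rewrite -Hs -surjective_pairing Te.
have L0 x : x != e -> inverted w x.1 x.2 = false -> L x = set0.
  by move=> xe f; apply/eqP; rewrite -[_ == _]negbK H0 ?f.
have [epq|npq] := eqVneq (p, q) e.
  have [Ep Eq] : p = w j /\ q = w i by case: epq.
  have n1 : (q, r) != e by apply/eqP => -[E1 E2]; move: pq; rewrite E1 Ep ltnn.
  have n2 : (p, r) != e by apply/eqP => -[E1 E2]; move: qr; rewrite E2 Eq ltnn.
  rewrite epq Tee (Te _ n1) (Te _ n2).
  have pqn : pos r != i :> nat.
    by rewrite -pos_wi -Eq pos_neq // -val_eqE /=; lia.
  have prn : pos r != j :> nat.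
    by rewrite -pos_wj -Ep pos_neq // -val_eqE /=; lia.
  have [ri|ir] := ltnP (pos r) i.
    apply: triple_ok_addX; [exact: bound|exact: sbound|exact: sbound|].
    by rewrite H0 // /inverted /= qr Eq pos_wi.
  rewrite (L0 _ n2) ?triple_ok_set0 // /inverted /= Ep pos_wj.
  by lia.
have [eqr|nqr] := eqVneq (q, r) e.
  have [Eq Er] : q = w j /\ r = w i by case: eqr.
  have n2 : (p, r) != e by apply/eqP => -[E1 E2]; move: pq; rewrite E1 Eq ltnn.
  rewrite eqr Tee (Te _ npq) (Te _ n2).
  have pqn : pos p != i :> nat.
    by rewrite -pos_wi -Er pos_neq // -val_eqE /=; lia.
  have prn : pos p != j :> nat.
    by rewrite -pos_wj -Eq pos_neq // -val_eqE /=; lia.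
  have [pi|ip] := ltnP (pos p) i.
    by rewrite (L0 _ n2) ?triple_ok_set0 // /inverted /= Er pos_wi; lia.
  apply: triple_ok_addY; [exact: bound|exact: bound|exact: bound| |].
    by rewrite H0 // /inverted /= pq Eq pos_wj; lia.
  rewrite H0 // /inverted /= Er pos_wi; move: pq; rewrite Eq => pq; lia.
have [epr|npr] := eqVneq (p, r) e; last by rewrite !Te.
have [Ep Er] : p = w j /\ r = w i by case: epr.
rewrite epr Tee (Te _ npq) (Te _ nqr).
have pqn : pos q != i :> nat.
  by rewrite -pos_wi -Er pos_neq // -val_eqE /=; lia.
have prn : pos q != j :> nat.
  by rewrite -pos_wj -Ep pos_neq // -val_eqE /=; lia.
have [qi|iq] := ltnP (pos q) i.
  have -> : L (q, r) = set0.
    by apply: L0 => //; rewrite /inverted /= Er pos_wi; lia.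
  by apply: triple_ok_addZ_Y0; apply: sbound.
have -> : L (p, q) = set0.
  by apply: L0 => //; rewrite /inverted /= Ep pos_wj; lia.
by apply: triple_ok_addZ_X0; apply: bound.
Qed.

(** Undoing the last step: if t was the only label of e, that step created the
    inversion and the previous permutation is sw; otherwise it had no effect
    and the previous permutation is w.  What remains to be seen is that t has
    left row i, which again follows from the triples containing e. *)
Lemma valid_add L : t \notin L e ->
  valid (stage t i) w (add_label t e L)
  = valid (stage t j) (if L e == set0 then sw else w) L.
Proof.
move=> tL; set T := add_label t e L; set w' := if _ then _ else _.
have Te x : x != e -> T x = L x by rewrite ffunE => /negPf ->.
have Tee : T e = t |: L e by rewrite ffunE eqxx.
have LT x s : s \in L x -> s \in T x.
  by rewrite ffunE; case: eqP => // _ sL; rewrite inE sL orbT.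
have pos' v : (w'^-1)%g v = if L e == set0 then tperm i j (pos v) else pos v.
  by rewrite /w'; case: eqP => // _; apply: pos_swap.
have Hinv : (forall u v, (T (u, v) != set0) = inverted w u v) <->
            (forall u v, (L (u, v) != set0) = inverted w' u v).
  have ie : inverted w e.1 e.2 by rewrite /inverted /= wij pos_wi pos_wj ij /=.
  have Te0 : T e != set0 by apply/set0Pn; exists t; rewrite Tee setU11.
  have ie' : (L e != set0) = inverted w' e.1 e.2.
    rewrite /w'; case: eqP => // _; rewrite /inverted wij !pos_swap pos_wi pos_wj.
    by rewrite tpermL tpermR ij /=; lia.
  have ne u v : (u, v) != e -> inverted w' u v = inverted w u v.
    by rewrite /w'; case: ifP => // _; apply: inverted_swap.
  split=> H u v; case: (eqVneq (u, v) e) => uve.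
  - by rewrite uve ie'; case: uve => -> ->.
  - by rewrite -(Te _ uve) ne.
  - by rewrite uve Te0; case: uve => -> ->.
  - by rewrite (Te _ uve) -ne.
apply/validP/validP => -[Hs Ht Hr].
  have bound x y s : s \in L (x, y) -> (s <= t)%N.
    by case/LT/Hr/andP => _ /orP[/ltnW//|/andP[/eqP-> _]].
  have Ht' p q r : (p < q)%N -> (q < r)%N ->
      triple_ok (L (p, q)) (L (q, r)) (L (p, r)).
    move=> pq qr; rewrite -triple_ok_add //; first exact: Ht.
    move=> u v s sL; split=> [|st]; first exact: bound sL.
    by have := Hr _ _ _ (LT _ _ sL); rewrite st /stage ltnn eqxx => /andP[].
  split=> //; first exact/Hinv.
  move=> u v s sL; rewrite /stage pos'.
  have := Hr _ _ _ (LT _ _ sL); rewrite /stage => /andP[sv].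
  have T0 x y : inverted w x y = false -> T (x, y) = set0.
    by move=> f; apply/eqP; rewrite -[_ == _]negbK Hs f.
  have Lw x y : (x, y) != e -> (L (x, y) != set0) = inverted w x y.
    by move=> ne; rewrite -Hs Te.
  case: (boolP (L e == set0)) => Le0.
    case/orP => [st|/andP[/eqP/val_inj st iv]].
      rewrite st /= andbT; case: tpermP => [E|E|_ _] //; last by lia.
      by rewrite ij; lia.
    rewrite st eqxx ltnn /=.
    (* The row of w j becomes row i of sw, so it must not contain t. *)
    case: tpermP => [E|E|ni nj]; first by rewrite leqnn andbT ij; lia.
      have Ev : v = w j by rewrite -E permKV.
      have nue : (u, v) != e.
        by apply/eqP => -[_ E2]; move: wij; rewrite -E2 Ev ltnn.
      have: inverted w u v by rewrite -Lw //; apply/set0Pn; exists s.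
      rewrite Ev => /andP[uj pu]; rewrite pos_wj in pu.
      have tL' : t \in L (u, w j) by rewrite -st -Ev.
      have nui : (u, w i) != e.
        by apply/eqP => -[E1]; move: uj; rewrite E1 ltnn.
      have := Ht _ _ _ uj wij; rewrite -/e Tee (eqP Le0) setU0.
      rewrite (Te (u, w j)); last by rewrite -Ev.
      rewrite (Te _ nui).
      have L1 : L (u, w i) != set0 by rewrite Lw // /inverted pos_wi; lia.
      have L2 : L (u, w j) != set0 by apply/set0Pn; exists t.
      rewrite -(setU0 [set t]) (@triple_ok_addY _ _ set0 _ t) //;
        [|exact: bound|by move=> y; rewrite inE|exact: bound].
      case/set0Pn: L1 => z zL /triple_okY0P/(_ t z tL' zL).
      by rewrite ltnNge (bound _ _ _ zL).
    have : pos v <> i :> nat by move/val_inj.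
    by rewrite ij; lia.
  case/orP => [st|/andP[/eqP/val_inj st iv]]; first by rewrite sv st.
  rewrite sv st eqxx ltnn /= ij ltn_neqAle iv andbT.
  (* A second label t in row i, at a pair (u, w i), is excluded. *)
  apply/negP => /eqP/val_inj Ei.
  have Ev : v = w i by rewrite Ei permKV.
  have tu : t \in L (u, w i) by rewrite -st -Ev.
  have une : (u, w i) != e by apply: contraNneq tL => <-.
  have uj : u != w j by apply: contraNneq une => ->.
  have: inverted w u (w i) by rewrite -Lw //; apply/set0Pn; exists t.
  rewrite /inverted pos_wi => /andP[ui pu].
  have pju : (j < pos u)%N by have := pos_neq uj; rewrite pos_wj; lia.
  have [ult|] := ltnP u (w j).
    have X0 : L (u, w j) != set0.
      rewrite Lw /inverted ?pos_wj ?ult //.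
      by apply/eqP => -[_ E2]; move: wij; rewrite E2 ltnn.
    have := triple_ok_notinZ (@bound _ _) (@bound _ _) X0 Le0 tL (Ht' _ _ _ ult wij).
    by rewrite tu.
  rewrite leq_eqVlt eq_sym (inj_eq val_inj) (negPf uj) /= => ju.
  have := Ht _ _ _ ju ui; rewrite -/e Tee (T0 (w j)); last by rewrite /inverted pos_wj; lia.
  rewrite (Te _ une) triple_okX0 => /betweenX0P H.
  case/set0Pn: Le0 => z zL; have := H t z tu; rewrite inE zL orbT => /(_ isT) tz.
  move/negP: tL; apply; rewrite (_ : t = z) //.
  by apply/val_inj/eqP; rewrite /= eqn_leq tz; apply: (bound (w j) (w i)).
have bound x y s : s \in L (x, y) -> (s <= t)%N.
  by case/Hr/andP => _ /orP[/ltnW//|/andP[/eqP-> _]].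
have Hs' := proj2 Hinv Hs.
have Hr' u v s : s \in L (u, v) -> stage t i s (pos v).
  move=> /Hr; rewrite /stage pos'; case: ifP => _ /andP[sv stv]; last first.
    by rewrite sv /=; case/orP: stv => [->//|/andP[-> jv]]; apply/orP; right=> /=; lia.
  move: sv stv; case: tpermP => [->|->|_ _] sv stv; apply/andP; split; lia.
split=> //.
  move=> p q r pq qr; rewrite triple_ok_add //; first exact: Ht.
  move=> u v s /Hr'; rewrite /stage => H; split; first by lia.
  by move=> st; move: H; rewrite st; lia.
move=> u v s; case: (eqVneq (u, v) e) => uve; last by rewrite (Te _ uve); apply: Hr'.
rewrite uve Tee in_setU1 => /predU1P[->|sL]; last by apply: (Hr' u); rewrite uve.
by case: uve => _ ->; rewrite /stage pos_wi ti eqxx leqnn ltnn.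
Qed.
End Step.
End Valid.

(** * The generating function of labellings as a 0-Hecke product *)

Section Recursion.
Variable n : nat.
Implicit Types (w : 'S_n) (L : labelling n) (u v s t i j : 'I_n) (P : rel nat).

(** Labellings without t at the pair e give the term f w; removing t from the
    others multiplies the weight by x_t, with a change of sign when other labels
    remain at e. *)
Lemma valid_sum_step t i j w : j = i.+1 :> nat -> (t <= i)%N ->
  valid_sum (stage t i) w
  = hecke_factor i j 'X_t [ffun w => valid_sum (stage t j) w] w.
Proof.
move=> ij ti; rewrite !ffunE {1}/valid_sum.
set e := (w j, w i); set sw := (tperm i j * w)%g.
rewrite (bigID (fun L => t \notin L e)) /=; congr (_ + _).
  by apply: eq_bigl => L; apply: valid_unused.
case: ifP => wij; last first.
  rewrite big_pred0 // => L; rewrite negbK; apply/negbTE/negP.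
  case/andP => /validP[Hs _ _] tL.
  have: inverted w (w j) (w i) by rewrite -Hs; apply/set0Pn; exists t.
  by rewrite /inverted wij.
have Einv w' L : valid (stage t j) w' L -> (L e == set0) = ~~ inverted w' e.1 e.2.
  by case/validP => <- _ _; rewrite negbK.
have ew : inverted w e.1 e.2 by rewrite /inverted wij !permK ij /=.
have esw : inverted sw e.1 e.2 = false.
  rewrite /inverted /sw !pos_swap // !permK tpermL tpermR ij.
  by apply/negP => /andP[_]; lia.
have tnot L : valid (stage t j) w L -> t \notin L e.
  by rewrite -(valid_unused ij ti) => /andP[].
have tnot' L : L e == set0 -> t \notin L e by move/eqP->; rewrite inE.
rewrite (reindex_onto (add_label t e) (del_label t e)) /=; last first.
  by move=> L; rewrite negbK => /andP[_]; apply: del_labelK.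
pose Q L := (t \notin L e) && valid (stage t j) (if L e == set0 then sw else w) L.
rewrite (eq_bigl Q); last first.
  move=> L; rewrite /Q negbK ffunE eqxx setU11 andbT.
  case: (boolP (t \in L e)) => tL /=; last first.
    by rewrite add_labelK // eqxx andbT valid_add.
  apply/negbTE/negP => /andP[_ /eqP/ffunP/(_ e)]; rewrite !ffunE !eqxx => E.
  by move: tL; rewrite -E !inE eqxx.
rewrite (eq_bigr (fun L => 'X_t * (if L e == set0 then \prod_x weight (L x)
                                   else - \prod_x weight (L x)))); last first.
  by move=> L /andP[tL _]; apply: prod_weight_add.
rewrite -mulr_sumr; congr (_ * _).
rewrite (bigID (fun L => L e == set0)) /=; congr (_ + _).
  rewrite /valid_sum (eq_bigl (valid (stage t j) sw)) => [|L].
    by apply: eq_bigr => L /Einv; rewrite esw => ->.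
  rewrite /Q; apply/andP/idP => [[/andP[_ V] L0]|V]; first by rewrite L0 in V.
  by have := Einv _ _ V; rewrite esw /= => L0; rewrite L0 tnot'.
rewrite /valid_sum -sumrN (eq_bigl (valid (stage t j) w)) => [|L].
  by apply: eq_bigr => L /Einv; rewrite ew => ->.
rewrite /Q; apply/andP/idP => [[/andP[_ V] L0]|V]; first by rewrite (negPf L0) in V.
by have := Einv _ _ V; rewrite ew /= => ->; rewrite tnot.
Qed.

(** The last row of the diagram is empty, so r.+1 < n may be assumed. *)
Lemma eq_valid P P' w L :
  (forall s r : nat, (s < n)%N -> (r.+1 < n)%N -> P s r = P' s r) ->
  valid P w L = valid P' w L.
Proof.
suff imp (P1 P2 : rel nat) :
    (forall s r : nat, (s < n)%N -> (r.+1 < n)%N -> P1 s r = P2 s r) ->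
    valid P1 w L -> valid P2 w L.
  by move=> H; apply/idP/idP; apply: imp => // s r sn rn; rewrite H.
move=> H /validP[Hs Ht Hr]; apply/validP; split=> // u v s sL.
rewrite -H; [exact: Hr sL|exact: ltn_ord|].
have: inverted w u v by rewrite -Hs; apply/set0Pn; exists s.
by case/andP => _ /leq_ltn_trans; apply; apply: ltn_ord.
Qed.

Lemma eq_valid_sum P P' w :
  (forall s r : nat, (s < n)%N -> (r.+1 < n)%N -> P s r = P' s r) ->
  valid_sum P w = valid_sum P' w.
Proof. by move=> H; apply: eq_bigl => L; apply: eq_valid. Qed.

Lemma perm_increasing w :
  (forall u v, (u < v)%N -> (w u < w v)%N) -> w = 1%g.
Proof.
have geq (s : 'S_n) : (forall u v, (u < v)%N -> (s u < s v)%N) ->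
    forall u, (u <= s u)%N.
  move=> H [u un]; elim: u un => [//|u IH] un /=.
  apply: leq_ltn_trans (IH (ltnW un)) _; exact: H.
move=> H; apply/permP => u; rewrite perm1; apply/val_inj/eqP.
rewrite eqn_leq geq // andbT -{2}(permK w u); apply: geq => x y xy.
rewrite ltnNge; apply/negP; rewrite leq_eqVlt => /predU1P[/val_inj/perm_inj E|/H].
  by move: xy; rewrite E ltnn.
by rewrite !permKV ltnNge ltnW.
Qed.

Lemma valid_sum_empty w :
  valid_sum (fun _ _ => false) w = (w == 1%g)%:R.
Proof.
have E L : valid (fun _ _ => false) w L = (w == 1%g) && (L == [ffun => set0]).
  apply/validP/andP => [[Hs _ Hr]|[/eqP -> /eqP ->]].
    have L0 u v : L (u, v) = set0 by apply/setP => s; rewrite inE; apply/negP => /Hr.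
    split; last by apply/eqP/ffunP => -[u v]; rewrite L0 ffunE.
    rewrite -eq_invg1; apply/eqP/perm_increasing => u v uv.
    have := Hs u v; rewrite L0 eqxx /inverted uv /= => /esym/negbT.
    rewrite -leqNgt leq_eqVlt => /predU1P[/val_inj/perm_inj E|//].
    by move: uv; rewrite E ltnn.
  split=> [u v|p q r _ _|u v s]; rewrite !ffunE.
  - rewrite eqxx /inverted invg1 !perm1; lia.
  - exact: triple_ok_set0.
  - by rewrite inE.
rewrite /valid_sum (eq_bigl _ _ E); case: eqP => _ /=; last by rewrite big_pred0.
rewrite big_pred1_eq big1 // => e _.
by rewrite ffunE /weight cards0 big_set0 mul1r.
Qed.

End Recursion.

Section ValidProduct.
Variable m : nat.
Implicit Types (w : 'S_m.+1) (t a : nat).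

Lemma valid_sum_row t a : (t <= a)%N -> (a <= m)%N ->
  [ffun w : 'S_m.+1 => valid_sum (stage t a) w]
  = hecke_row a 'X_(inord t) [ffun w => valid_sum (stage t m) w].
Proof.
have [k] := ubnP (m - a); elim: k a => // k IH a ka ta.
rewrite leq_eqVlt => /predU1P[->|am]; first by rewrite hecke_row_last.
rewrite hecke_rowS // -IH //; [|lia..].
apply/ffunP => w; rewrite ffunE.
have := @valid_sum_step m.+1 (inord t) (inord a) (inord a.+1) w.
by rewrite !inordK; [apply=> //|lia..].
Qed.

Lemma valid_sum_stage t : (t <= m)%N ->
  [ffun w : 'S_m.+1 => valid_sum (stage t m) w] = hecke_product m t.
Proof.
elim: t => [_|t IH tm] /=.
  apply/ffunP => w; rewrite !ffunE -valid_sum_empty; apply: eq_valid_sum.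
  by move=> s r _ rm; rewrite /stage; lia.
rewrite -IH; last exact: ltnW.
rewrite -valid_sum_row; [|exact: leqnn|exact: ltnW].
apply/ffunP => w; rewrite !ffunE; apply: eq_valid_sum => s r _ rm.
by rewrite /stage; lia.
Qed.

Lemma valid_sum_product w : valid_sum leq w = hecke_product m m.+1 w.
Proof.
rewrite /= hecke_row_last // -valid_sum_stage // ffunE.
by apply: eq_valid_sum => s r sm rm; rewrite /stage; lia.
Qed.

End ValidProduct.

(** * The longest permutation *)

Section Base.
Variable n : nat.
Implicit Types (w : 'S_n) (L : labelling n) (u v s t i j : 'I_n).

Lemma no_ascent_w0 w : (forall i j, ~~ ascent w i j) -> w = w0 n.
Proof.
move=> H.
have dec (k : nat) i j : j = (i + k.+1)%N :> nat -> (w j < w i)%N.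
  elim: k j => [|k IH] j jk.
    have := H i j; rewrite /ascent jk addn1 eqxx /= -leqNgt leq_eqVlt.
    by case/predU1P => [/val_inj/perm_inj E|//]; move: jk; rewrite E; lia.
  have lt : (i + k.+1 < n)%N by have := ltn_ord j; lia.
  apply: ltn_trans (IH (Ordinal lt) erefl).
  have := H (Ordinal lt) j; rewrite /ascent /= jk addnS eqxx /= -leqNgt leq_eqVlt.
  by case/predU1P => [/val_inj/perm_inj E|//]; move: jk; rewrite E /=; lia.
have : (w * w0 n)%g = 1%g.
  apply: perm_increasing => u v uv; rewrite !permM /w0 !permE /=.
  have := dec (v - u).-1 u v; have := ltn_ord (w u); have := ltn_ord (w v).
  lia.
move/(canRL (mulgK _)); rewrite mul1g => ->.
apply/permP => x; apply: (@perm_inj _ (w0 n)); rewrite permKV.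
by rewrite /w0 !permE rev_ordK.
Qed.

Lemma w0V : (w0 n)^-1%g = w0 n.
Proof.
apply/permP => x; apply: (@perm_inj _ (w0 n)); rewrite permKV.
by rewrite /w0 !permE rev_ordK.
Qed.

Lemma inverted_w0 u v : inverted (w0 n) u v = (u < v)%N.
Proof.
rewrite /inverted w0V /w0 !permE /=; have := ltn_ord u; have := ltn_ord v.
by case: ltnP => //=; lia.
Qed.

(** The only labelling puts {i} in all the boxes of row i: down a column, the
    flag condition allows i + 1 labels in the i-th box and column-strictness
    excludes those used above. *)
Lemma valid_sum_w0 : valid_sum leq (w0 n) = groth_w0 n.
Proof.
pose L0 : labelling n :=
  [ffun e : 'I_n * 'I_n => if (e.1 < e.2)%N then [set w0 n e.2] else set0].
have lt0 u v : (u < v)%N -> (w0 n v < w0 n u)%N.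
  by rewrite /w0 !permE /=; have := ltn_ord v; lia.
have E L : valid leq (w0 n) L = (L == L0).
  apply/validP/eqP => [[Hs Ht Hr]|->].
    have disj u v v' : (u < v)%N -> (u < v')%N -> v != v' :> nat ->
        [disjoint L (u, v) & L (u, v')].
      move=> uv uv'; rewrite neq_ltn => /orP[vv'|v'v].
        by case/andP: (Ht _ _ _ uv vv').
      by case/andP: (Ht _ _ _ uv' v'v); rewrite disjoint_sym.
    have row (k : nat) u v : w0 n v = k :> nat -> (u < v)%N -> L (u, v) = [set w0 n v].
      elim/ltn_ind: k v => k IH v vk uv.
      have sub s : s \in L (u, v) -> s = w0 n v.
        move=> sL; have := Hr _ _ _ sL; rewrite w0V leq_eqVlt.
        case/predU1P => [/val_inj //|sv].
        have ws : w0 n (w0 n s) = s by rewrite -{1}w0V permK.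
        have us : (u < w0 n s)%N.
          move: sv; rewrite /w0 !permE /=; have := ltn_ord s; have := ltn_ord v.
          have := ltn_ord u; lia.
        have vs : v != w0 n s :> nat.
          by apply/eqP => /val_inj E; move: sv; rewrite E ws ltnn.
        have := IH s _ (w0 n s); rewrite ws -vk => /(_ sv erefl us) E.
        have := disj _ _ _ uv us vs; rewrite E => /disjoint_neq/(_ sL (set11 _)).
        by rewrite eqxx.
      apply/eqP; rewrite eqEsubset; apply/andP; split.
        by apply/subsetP => s /sub ->; rewrite inE.
      have : L (u, v) != set0 by rewrite Hs inverted_w0.
      by case/set0Pn => s sL; rewrite sub1set -(sub s).
    apply/ffunP => -[u v]; rewrite ffunE /=; case: ltnP => uv; first exact: row.
    by apply/eqP; rewrite -[_ == _]negbK Hs inverted_w0 ltnNge uv.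
  split=> [u v|p q r pq qr|u v s].
  - rewrite ffunE inverted_w0 /=; case: ltnP => _; last by rewrite eqxx.
    by apply/set0Pn; exists (w0 n v); rewrite inE.
  - rewrite !ffunE /= pq qr (ltn_trans pq qr); have := lt0 _ _ qr => rq.
    apply/andP; split.
      by apply: disjoint_neqP => x z; rewrite !inE => /eqP-> /eqP->; rewrite neq_ltn rq orbT.
    apply/betweenP => z; rewrite !inE !min_label_set1 rq => /eqP ->.
    by split=> [|y]; [exact: ltnW|rewrite inE => /eqP ->].
  - by rewrite ffunE /= w0V; case: ltnP => _; rewrite inE // => /eqP ->.
rewrite /valid_sum (eq_bigl _ _ E) big_pred1_eq /groth_w0.
rewrite (reindex_inj (@perm_inj _ (w0 n))) /=.
rewrite (eq_bigr (fun e => weight (L0 (e.1, e.2)))) => [|[]//].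
rewrite -(pair_bigA _ (fun u v => weight (L0 (u, v)))) exchange_big /=.
apply: eq_bigr => v _.
rewrite (eq_bigr (fun u => if (u < v)%N then 'X_(w0 n v) else 1)); last first.
  move=> u _; rewrite ffunE /=; case: ifP => _.
    by rewrite /weight cards1 big_set1 expr0 mul1r.
  by rewrite /weight cards0 big_set0 mul1r.
rewrite -big_mkcond (big_ord_narrow (ltnW (ltn_ord v))) prodr_const card_ord.
by rewrite /w0 permE /= subnSK // subKn // ltnW.
Qed.

End Base.

(** * Hooks with at most one box in the arm and in the leg *)

Section Sort.
Implicit Types x y z : nat.

Lemma nth0_sort2 x y : nth 0%N (sort leq [:: x; y]) 0 = minn x y.
Proof. by rewrite /sort /=; case: leqP. Qed.

Lemma nth1_sort2 x y : nth 0%N (sort leq [:: x; y]) 1 = maxn x y.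
Proof. by rewrite /sort /=; case: leqP. Qed.

Lemma nth1_sort3 x y z : (nth 0%N (sort leq [:: x; y; z]) 1 == y)
  = (x <= y <= z)%N || (z <= y <= x)%N.
Proof.
by rewrite /sort /=; case: (leqP x y) => xy /=; case: leqP => h1 /=;
   try case: leqP => h2 /=; try case: leqP => h3 /=; lia.
Qed.
End Sort.

Section Hooks.
Variable n : nat.
Local Notation box := ('I_n * 'I_n)%type.
Implicit Types (S : {set box}) (T : labelling n) (a b c : box).

Lemma mem_arm S a b : (b \in arm S a) = [&& b \in S, b.1 == a.1 & (a.2 < b.2)%N].
Proof.
rewrite mem_filter; case: (b \in S) => //=; case: (ltnP a.2 b.2) => _; rewrite ?andbF //= andbT.
apply/mapP/eqP => [[c _ -> //]|E]; exists b.2; first by rewrite mem_rev mem_enum.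
by rewrite -E -surjective_pairing.
Qed.

Lemma mem_leg S a b : (b \in leg S a) = [&& b \in S, b.2 == a.2 & (a.1 < b.1)%N].
Proof.
rewrite mem_filter; case: (b \in S) => //=; case: (ltnP a.1 b.1) => _; rewrite ?andbF //= andbT.
apply/mapP/eqP => [[c _ -> //]|E]; exists b.1; first by rewrite mem_enum.
by rewrite -E -surjective_pairing.
Qed.

Lemma uniq_arm S a : uniq (arm S a).
Proof.
by apply/filter_uniq; rewrite map_inj_uniq ?rev_uniq ?enum_uniq // => x y [].
Qed.

Lemma uniq_leg S a : uniq (leg S a).
Proof. by apply/filter_uniq; rewrite map_inj_uniq ?enum_uniq // => x y []. Qed.

Lemma seq_eq_if (s : seq box) b (C : bool) :
  uniq s -> (forall x, (x \in s) = C && (x == b)) ->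
  s = if C then [:: b] else [::].
Proof.
move=> us; case: C => E; apply: perm_small_eq => //; apply: uniq_perm => // x;
by rewrite E ?inE.
Qed.

Lemma hook_balanced_arm S T a b : a != b -> arm S a = [:: b] -> leg S a = [::] ->
  hook_balanced S T a = between set0 (T b) (T a).
Proof.
move=> ab Ea El; rewrite /hook_balanced /admissible /hook /rmin /bmin Ea El /=.
rewrite big_nil min_label0; apply/forallP/betweenX0P => [H y z yb za|H x].
  have := H [ffun b' => if b' == a then z else y].
  rewrite !ffunE eqxx eq_sym (negPf ab) za yb ltn_ord orbT /=.
  by rewrite nth1_sort2; lia.
apply/implyP; rewrite andbT => /andP[za /andP[/andP[yb _] _]]; rewrite nth1_sort2.
by apply/eqP/maxn_idPr; apply: H.
Qed.

Lemma hook_balanced_leg S T a c : a != c -> arm S a = [::] -> leg S a = [:: c] ->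
  hook_balanced S T a = between (T a) set0 (T c).
Proof.
move=> ac Ea El; rewrite /hook_balanced /admissible /hook /rmin /bmin Ea El /=.
rewrite big_nil min_label0; apply/forallP/betweenY0P => [H x z xa zc|H x].
  have := H [ffun b' => if b' == a then x else z].
  rewrite !ffunE eqxx eq_sym (negPf ac) xa zc (ltnW (ltn_ord z)) orbT /=.
  by rewrite nth0_sort2; lia.
apply/implyP; rewrite andbT => /andP[xa /andP[zc _]]; rewrite nth0_sort2.
by apply/eqP/minn_idPl; apply: H.
Qed.

Lemma hook_balanced_corner S T a : arm S a = [::] -> leg S a = [::] ->
  hook_balanced S T a.
Proof.
move=> Ea El; rewrite /hook_balanced /hook Ea El.
by apply/forallP => x; apply/implyP.
Qed.

(** The corner keeps its label when it is the median of the three labels picked.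
    If the minimum of the arm is the smaller one, the leg contributes its
    minimum only; otherwise the arm does. *)
Lemma hook_balanced_full S T a b c : a != b -> a != c -> b != c ->
  T b != set0 -> T c != set0 -> arm S a = [:: b] -> leg S a = [:: c] ->
  hook_balanced S T a = between (T c) (T b) (T a).
Proof.
move=> ab ac bc Tb0 Tc0 Ea El.
rewrite /hook_balanced /admissible /hook /rmin /bmin Ea El /=.
rewrite !big_seq1; apply/forallP/betweenP => [H z za|H x].
  have {}H y x : y \in T b -> x \in T c ->
      (y == min_label (T b) :> nat) || (y < min_label (T c))%N ->
      (x == min_label (T c) :> nat) || (x <= min_label (T b))%N ->
      (y <= z <= x)%N || (x <= z <= y)%N.
    move=> yb xc Hy Hx.
    have := H [ffun b' => if b' == a then z else if b' == b then y else x].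
    rewrite !ffunE !eqxx ![_ == a]eq_sym (negPf ab) (negPf ac) [c == b]eq_sym (negPf bc).
    by rewrite za yb xc Hx Hy /= nth1_sort3.
  move: H Tb0 Tc0; case: (min_labelP (T b)) => [->|y0 y0b y0m]; first by rewrite eqxx.
  case: (min_labelP (T c)) => [->|x0 x0c x0m]; first by rewrite eqxx.
  move=> H _ _; case: ltnP => yx.
    have E y : y \in T b -> (y < x0)%N -> (y <= z <= x0)%N.
      by move=> yb lt; have := H y x0 yb x0c; rewrite eqxx lt orbT => /(_ isT isT); lia.
    by split=> [|y yb lt]; [case/andP: (E y0 y0b yx)|case/andP: (E y yb lt)].
  have E x : x \in T c -> (x <= y0)%N -> (x <= z <= y0)%N.
    by move=> xc le; have := H y0 x y0b xc; rewrite eqxx le orbT => /(_ isT isT); lia.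
  by split=> [|x xc le]; [case/andP: (E x0 x0c yx)|case/andP: (E x xc le)].
apply/implyP; rewrite !andbT => /and3P[za /andP[yb Hy] /andP[xc Hx]].
rewrite nth1_sort3; have := H _ za.
have := min_label_leq yb; have := min_label_leq xc.
case: ifP => lt ? ? [z1 z2].
  have := z2 _ yb; lia.
have := z2 _ xc; lia.
Qed.

End Hooks.

(** * From labelled diagrams to labelled pairs of values *)

Section Conversion.
Variables (n : nat) (w : 'S_n).
Implicit Types (L : labelling n) (u v p q r i j k s t : 'I_n).

Definition diagram_labelling L : labelling n :=
  [ffun b : 'I_n * 'I_n => L (b.2, w b.1)].

Lemma diagram_labelling_bij : bijective diagram_labelling.
Proof.
exists (fun T : labelling n => [ffun e : 'I_n * 'I_n => T ((w^-1)%g e.2, e.1)]).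
  by move=> L; apply/ffunP => -[u v]; rewrite !ffunE /= permKV.
by move=> T; apply/ffunP => -[u v]; rewrite !ffunE /= permK.
Qed.

Lemma mem_diagram b : (b \in diagram w) = inverted w b.2 (w b.1).
Proof.
apply/imsetP/idP => [[[i j]]|].
  by rewrite inE => /andP[/= ij wij] ->; rewrite /inverted /= !permK ij wij.
case/andP => lt1; rewrite permK => lt2.
exists (b.1, (w^-1)%g b.2); first by rewrite inE /= permKV lt1 lt2.
by rewrite permKV; case: b {lt1 lt2}.
Qed.

Lemma mem_diagramE i j : ((i, w j) \in diagram w) = (i < j)%N && (w j < w i)%N.
Proof. by rewrite mem_diagram /inverted /= !permK andbC. Qed.

(** A subdiagram on three rows has at most the boxes (i, w j), (i, w k) and
    (j, w k), so that a hook has at most one box in its arm and one in its leg. *)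
Section Triple.
Variables (i j k : 'I_n) (ij : (i < j)%N) (jk : (j < k)%N) (T : labelling n).
Hypothesis T0 : forall b, b \in diagram w -> T b != set0.
Let S := subdiagram w i j k.

Lemma mem_subdiagram r s : ((r, w s) \in S) =
  [&& (r < s)%N, (w s < w r)%N, r \in [:: i; j; k] & s \in [:: i; j; k]].
Proof.
rewrite inE mem_diagramE /= -!andbA; do 2!congr (_ && _).
by rewrite !inE !(inj_eq perm_inj).
Qed.

Lemma arm_ij : (w j < w i)%N ->
  arm S (i, w j) = if (w j < w k < w i)%N then [:: (i, w k)] else [::].
Proof.
move=> wji; apply: seq_eq_if; first exact: uniq_arm.
case=> r c; rewrite -(permKV w c); move: ((w^-1)%g c) => s.
rewrite mem_arm mem_subdiagram /= xpair_eqE (inj_eq perm_inj) !inE.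
have [->|ri] := eqVneq r i; last by rewrite !andbF.
have [->|sk] := eqVneq s k; first by rewrite !orbT /=; lia.
have [->|sj] := eqVneq s j; first by rewrite ltnn !andbF.
have [->|si] := eqVneq s i; first by rewrite !ltnn !andbF.
by rewrite !andbF.
Qed.

Lemma leg_ij : leg S (i, w j) = [::].
Proof.
apply: (@seq_eq_if _ _ (i, i) false); first exact: uniq_leg.
case=> r c; rewrite -(permKV w c); move: ((w^-1)%g c) => s.
rewrite mem_leg mem_subdiagram /= (inj_eq perm_inj) !inE.
apply/negbTE/negP => /and3P[/and4P[rs _ + _] /eqP sj ir].
by rewrite sj in rs; case/or3P => /eqP E; rewrite E in rs ir; lia.
Qed.

Lemma arm_ik : (w k < w i)%N ->
  arm S (i, w k) = if (w k < w j < w i)%N then [:: (i, w j)] else [::].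
Proof.
move=> wji; apply: seq_eq_if; first exact: uniq_arm.
case=> r c; rewrite -(permKV w c); move: ((w^-1)%g c) => s.
rewrite mem_arm mem_subdiagram /= xpair_eqE (inj_eq perm_inj) !inE.
have [->|ri] := eqVneq r i; last by rewrite !andbF.
have [->|sj] := eqVneq s j; first by rewrite !orbT /=; lia.
have [->|sk] := eqVneq s k; first by rewrite ltnn !andbF.
have [->|si] := eqVneq s i; first by rewrite !ltnn !andbF.
by rewrite !andbF.
Qed.

Lemma leg_ik : (w k < w i)%N ->
  leg S (i, w k) = if (w k < w j)%N then [:: (j, w k)] else [::].
Proof.
move=> wki; apply: seq_eq_if; first exact: uniq_leg.
case=> r c; rewrite -(permKV w c); move: ((w^-1)%g c) => s.
rewrite mem_leg mem_subdiagram /= xpair_eqE !(inj_eq perm_inj) !inE.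
have [->|sk] := eqVneq s k; last by rewrite !andbF.
have [->|rj] := eqVneq r j; first by rewrite !orbT /=; lia.
have [->|rk] := eqVneq r k; first by rewrite ltnn !andbF.
have [->|ri] := eqVneq r i; first by rewrite !ltnn !andbF.
by rewrite !andbF.
Qed.

Lemma arm_jk : arm S (j, w k) = [::].
Proof.
apply: (@seq_eq_if _ _ (i, i) false); first exact: uniq_arm.
case=> r c; rewrite -(permKV w c); move: ((w^-1)%g c) => s.
rewrite mem_arm mem_subdiagram /= !inE.
apply/negbTE/negP => /and3P[/and4P[rs _ _ +] /eqP rj ir].
rewrite rj in rs; case/or3P => /eqP E; rewrite E in rs ir; try lia.
Qed.

Lemma leg_jk : leg S (j, w k) = [::].
Proof.
apply: (@seq_eq_if _ _ (i, i) false); first exact: uniq_leg.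
case=> r c; rewrite -(permKV w c); move: ((w^-1)%g c) => s.
rewrite mem_leg mem_subdiagram /= (inj_eq perm_inj) !inE.
apply/negbTE/negP => /and3P[/and4P[rs _ + _] /eqP sk ir].
by rewrite sk in rs; case/or3P => /eqP E; rewrite E in rs ir; lia.
Qed.

Lemma box_neq r s r' s' : (r != r') || (s != s') -> (r, w s) != (r', w s').
Proof. by rewrite xpair_eqE (inj_eq perm_inj) negb_and. Qed.

(** The three clauses are the patterns 312, 321 and 231 of w on i, j, k; in the
    other patterns every hook of the subdiagram is a single box. *)
Lemma subdiagram_balancedP : reflect
  [/\ (w j < w k < w i)%N -> between set0 (T (i, w k)) (T (i, w j)),
      (w k < w j < w i)%N -> between (T (j, w k)) (T (i, w j)) (T (i, w k))
    & (w k < w i < w j)%N -> between (T (i, w k)) set0 (T (j, w k))]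
  [forall a in S, hook_balanced S T a].
Proof.
have nij : i != j by rewrite -val_eqE /= neq_ltn ij.
have njk : j != k by rewrite -val_eqE /= neq_ltn jk.
apply: (iffP forall_inP) => [H|[H1 H2 H3] [r c]].
  split=> /andP[w1 w2].
  - have : (i, w j) \in S by rewrite mem_subdiagram ij (ltn_trans w1 w2) !inE !eqxx orbT.
    move/H; rewrite (hook_balanced_arm _ (b := (i, w k))) ?leg_ij //.
      by apply: box_neq; rewrite njk orbT.
    by rewrite arm_ij ?w1 ?w2 // (ltn_trans w1).
  - have wki := ltn_trans w1 w2.
    have : (i, w k) \in S by rewrite mem_subdiagram (ltn_trans ij jk) wki !inE !eqxx !orbT.
    move/H; rewrite (hook_balanced_full (b := (i, w j)) (c := (j, w k))) //.
    + by apply: box_neq; rewrite eq_sym njk orbT.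
    + by apply: box_neq; rewrite nij.
    + by apply: box_neq; rewrite nij.
    + by apply: T0; rewrite mem_diagramE ij.
    + by apply: T0; rewrite mem_diagramE jk.
    + by rewrite arm_ik // w1 w2.
    + by rewrite leg_ik // w1.
  - have : (i, w k) \in S by rewrite mem_subdiagram (ltn_trans ij jk) w1 !inE !eqxx !orbT.
    move/H; rewrite (hook_balanced_leg _ (c := (j, w k))) //.
    + by apply: box_neq; rewrite nij.
    + by rewrite arm_ik //; case: ifP => // /andP[_]; rewrite ltnNge ltnW.
    + by rewrite leg_ik // (ltn_trans w1 w2).
rewrite -(permKV w c); move: ((w^-1)%g c) => s; rewrite mem_subdiagram !inE.
case/and4P => rs wsr /or3P[] /eqP Er /or3P[] /eqP Es; subst r s; try lia.
- have [/andP[wjk wki]|no] := boolP (w j < w k < w i)%N.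
    rewrite (hook_balanced_arm _ (b := (i, w k))) ?leg_ij //; last by rewrite arm_ij // wjk wki.
      by apply: H1; rewrite wjk.
    by apply: box_neq; rewrite njk orbT.
  by apply: hook_balanced_corner; rewrite ?leg_ij // arm_ij // (negPf no).
- have [wkj|wjk] := ltnP (w k) (w j); last first.
    apply: hook_balanced_corner; rewrite ?arm_ik ?leg_ik // ltnNge wjk //.
  have [wji|wij] := ltnP (w j) (w i).
    rewrite (hook_balanced_full (b := (i, w j)) (c := (j, w k))) ?arm_ik ?leg_ik ?wkj ?wji //.
    + by apply: H2; rewrite wkj.
    + by apply: box_neq; rewrite eq_sym njk orbT.
    + by apply: box_neq; rewrite nij.
    + by apply: box_neq; rewrite nij.
    + by apply: T0; rewrite mem_diagramE ij.
    + by apply: T0; rewrite mem_diagramE jk.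
  rewrite (hook_balanced_leg _ (c := (j, w k))).
  + apply: H3; rewrite wsr ltn_neqAle wij andbT (inj_eq val_inj) (inj_eq perm_inj) //.
  + by apply: box_neq; rewrite nij.
  + by rewrite arm_ik // [X in _ && X]ltnNge wij andbF.
  + by rewrite leg_ik // wkj.
- by apply: hook_balanced_corner; rewrite ?arm_jk ?leg_jk.
Qed.
End Triple.

(** Column-strictness is the disjointness in triple_ok, since two boxes of the
    column p lie in the rows of two values q, r > p. *)
Lemma diagram_labellingP L :
  [&& set_valued w (diagram_labelling L), column_strict w (diagram_labelling L),
      balanced w (diagram_labelling L) & flagged w (diagram_labelling L)]
  = valid leq w L.
Proof.
set T := diagram_labelling L.
have TE r s : T (r, w s) = L (w s, w r) by rewrite ffunE.
have TL u v : L (u, v) = T ((w^-1)%g v, u) by rewrite ffunE /= permKV.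
have dE u v : (((w^-1)%g v, u) \in diagram w) = inverted w u v.
  by rewrite mem_diagram /= permKV.
have svE : set_valued w T = [forall u : 'I_n, forall v : 'I_n, (L (u, v) != set0) == inverted w u v].
  apply/forallP/forallP => [H u|H [r c]].
    by apply/forallP => v; have := H ((w^-1)%g v, u); rewrite -TL dE eq_sym.
  by have := forallP (H c) (w r); rewrite mem_diagram ffunE eq_sym.
rewrite /valid svE; case: forallP => //= Hs0.
have {Hs0 svE} Hs u v : (L (u, v) != set0) = inverted w u v.
  by have /forallP/(_ v)/eqP := Hs0 u.
have T0 b : b \in diagram w -> T b != set0.
  by case: b => r c; rewrite mem_diagram ffunE Hs.
have L0 u v : inverted w u v = false -> L (u, v) = set0.
  by move=> f; apply/eqP; rewrite -[_ == _]negbK Hs f.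
apply/and3P/andP => [[Hc Hb Hf]|[Ht Hr]].
  split.
    apply/forallP => p; apply/forallP => q; apply/forallP => r.
    apply/implyP => /andP[pq qr].
    have [prI|prN] := boolP (inverted w p r); last first.
      by rewrite (L0 p r (negPf prN)) triple_ok_set0.
    apply/andP; split.
      have [pqI|pqN] := boolP (inverted w p q); last first.
        by rewrite (L0 _ _ (negPf pqN)) disjoints_subset sub0set.
      move/forall_inP: Hc => /(_ ((w^-1)%g q, p)); rewrite dE => /(_ pqI).
      move/forall_inP => /(_ ((w^-1)%g r, p)); rewrite dE => /(_ prI).
      rewrite /= eqxx andbT -!TL => /implyP; apply.
      rewrite xpair_eqE (inj_eq perm_inj) eqxx andbT -val_eqE /= neq_ltn qr //.
    have Hb3 i j k : (i < j)%N -> (j < k)%N ->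
        [forall a in subdiagram w i j k, hook_balanced (subdiagram w i j k) T a].
      move=> ij jk; move/forallP/(_ i)/forallP/(_ j)/forallP/(_ k): Hb.
      by rewrite ij jk.
    case/andP: prI => pr; set i := (w^-1)%g r; set k := (w^-1)%g p => ik.
    rewrite -(permKV w p) -(permKV w q) -(permKV w r) -/i -/k.
    set j := (w^-1)%g q.
    have [Ei Ej Ek] : [/\ w i = r, w j = q & w k = p] by rewrite !permKV.
    have ji : j != i :> nat by apply: pos_neq; rewrite -val_eqE /= neq_ltn qr.
    have jk : j != k :> nat by apply: pos_neq; rewrite -val_eqE /= neq_ltn pq orbT.
    rewrite -!TE.
    have [jlti|ilej] := ltnP j i.
      have [_ _] := subdiagram_balancedP jlti ik T0 (Hb3 _ _ _ jlti ik).
      rewrite Ei Ej Ek pq qr => /(_ isT).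
      by have -> : T (i, q) = set0 by rewrite -Ej TE L0 // /inverted !permK; lia.
    have iltj : (i < j)%N by rewrite ltn_neqAle eq_sym ji.
    have [jltk|klej] := ltnP j k.
      have [_ + _] := subdiagram_balancedP iltj jltk T0 (Hb3 _ _ _ iltj jltk).
      by rewrite Ei Ej Ek pq qr => /(_ isT).
    have kltj : (k < j)%N by rewrite ltn_neqAle eq_sym jk.
    have [+ _ _] := subdiagram_balancedP ik kltj T0 (Hb3 _ _ _ ik kltj).
    rewrite Ei Ej Ek pq qr => /(_ isT).
    by have -> : T (j, p) = set0 by rewrite -Ek TE L0 // /inverted !permK; lia.
  apply/forallP => u; apply/forallP => v; apply/forall_inP => s sL.
  move/forall_inP: Hf => /(_ ((w^-1)%g v, u)); rewrite dE -Hs => Hf.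
  have : L (u, v) != set0 by apply/set0Pn; exists s.
  by move/Hf/forall_inP; apply; rewrite -TL.
have {}Ht p q r : (p < q)%N -> (q < r)%N -> triple_ok (L (p, q)) (L (q, r)) (L (p, r)).
  by move=> pq qr; move/forallP/(_ p)/forallP/(_ q)/forallP/(_ r): Ht; rewrite pq qr.
split.
- apply/forall_inP => -[r c]; rewrite mem_diagram /= => I1.
  apply/forall_inP => -[r' c']; rewrite mem_diagram /= => I2.
  apply/implyP => /andP[ne /eqP /= E]; subst c'.
  have : w r != w r' :> nat.
    by move: ne; rewrite xpair_eqE eqxx andbT; apply: contraNneq => /val_inj/perm_inj ->.
  rewrite !ffunE /= neq_ltn.
  case/andP: I1 => c1 _; case/andP: I2 => c2 _.
  case/orP => lt; first by case/andP: (Ht _ _ _ c1 lt).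
  by case/andP: (Ht _ _ _ c2 lt); rewrite disjoint_sym.
- apply/forallP => i; apply/forallP => j; apply/forallP => k.
  apply/implyP => /andP[ij jk]; apply/(subdiagram_balancedP ij jk T0).
  rewrite !TE; split=> /andP[w1 w2]; case/andP: (Ht _ _ _ w1 w2) => _.
  + rewrite (L0 (w j) (w k)) // /inverted !permK; lia.
  + done.
  + rewrite (L0 (w i) (w j)) // /inverted !permK; lia.
- apply/forall_inP => -[r c] _; apply/forall_inP => s; rewrite ffunE /= => sL.
  by move/forallP/(_ c)/forallP/(_ (w r))/forall_inP: Hr => /(_ s sL); rewrite permK.
Qed.

Lemma diagram_labelling_weight L : valid leq w L ->
  (-1) ^+ (label_count w (diagram_labelling L) - ell w)
    * label_monomial w (diagram_labelling L) = \prod_e weight (L e).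
Proof.
set T := diagram_labelling L => /validP[Hs _ _].
have T0 b : (T b != set0) = (b \in diagram w).
  by case: b => r c; rewrite mem_diagram ffunE Hs.
have -> : \prod_e weight (L e) = \prod_(b in diagram w) weight (T b).
  rewrite [RHS]big_mkcond /=.
  have inj : injective (fun b : 'I_n * 'I_n => (b.2, w b.1)).
    by move=> [a b] [c d] [-> /perm_inj ->].
  rewrite (reindex_inj inj) /=; apply: eq_bigr => b _.
  rewrite -T0 ffunE; case: eqP => //= ->.
  by rewrite /weight cards0 big_set0 mul1r.
rewrite /weight big_split /= prodrXr; congr (_ ^+ _ * _).
have -> : ell w = #|diagram w|.
  rewrite /ell /diagram card_imset // => -[a b] [c d] [-> /perm_inj -> //].
rewrite /label_count -sum1_card -sumnB => [|b]; last by rewrite -T0 card_gt0.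
by apply: eq_bigr => b _; rewrite subn1.
Qed.

End Conversion.

(** * The expansion of Grothendieck polynomials *)

(** Both families satisfy the same recursion along ascents and agree at the
    longest permutation, which is the only one without ascents. *)
Lemma grothendieck_valid_sum n (w : 'S_n) : grothendieck w = valid_sum leq w.
Proof.
have [k] := ubnP #|noninv w|; elim: k w => // k IH w; rewrite ltnS => wk.
rewrite grothendieck_pick; case: pickP => [[i j] /= asc|no].
  rewrite IH; last exact: leq_trans (noninv_ltn asc) wk.
  case: n w wk i j asc IH => [|m] w wk i j asc _; first by case: i asc.
  by rewrite !valid_sum_product -hecke_product_isobaric.
by rewrite (no_ascent_w0 (w := w)) ?valid_sum_w0 // => i j; rewrite (no (i, j)).
Qed.

Theorem theorem3p15 (n : nat) (w : 'S_n) :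
  grothendieck w =
  \sum_(T : labelling n | [&& set_valued w T, column_strict w T,
                              balanced w T & flagged w T])
    (-1) ^+ (label_count w T - ell w)%N * label_monomial w T.
Proof.
rewrite grothendieck_valid_sum (reindex (diagram_labelling w)) /=; last first.
  exact/onW_bij/diagram_labelling_bij.
rewrite /valid_sum; apply: eq_big => L; first by rewrite diagram_labellingP.
by move=> V; rewrite diagram_labelling_weight.
Qed.
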